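(* (Completeness.) Let $\Sigma$ be an at most countable transition-algebra signature. For every set $\Gamma$ of $\Sigma$-sentences and every $\Sigma$-sentence $\phi$: $\Gamma\vdash_\Sigma\phi$ if and only if $\Gamma\models_\Sigma\phi$.
   Context: Transition algebra (TA). A signature $\Sigma=(S,F\supseteq M,L)$ consists of a set $S$ of sorts, function symbols $F=\{F_{w,s}\}$, monotonic function symbols $M\subseteq F$ and transition labels $L$; it is at most countable if $S$, $F$, $L$ are. A $\Sigma$-model $\mathfrak A$ is a many-sorted $(S,F)$-algebra (carriers may be empty) with relations $\lambda^{\mathfrak A}_s\subseteq\mathfrak A_s\times\mathfrak A_s$ for $\lambda\in L$ such that each $\sigma\in M$ is monotone in each argument (if $(a_k,b)\in\lambda^{\mathfrak A}$ then $(\sigma^{\mathfrak A}(\dots,a_k,\dots),\sigma^{\mathfrak A}(\dots,b,\dots))\in\lambda^{\mathfrak A}$). Actions $\mathfrak a::=\lambda\mid\mathfrak a\mathbin{;}\mathfrak a\mid\mathfrak a\cup\mathfrak a\mid\mathfrak a^*$, interpreted by $\lambda^{\mathfrak A}$, relational composition, union and reflexive–transitive closure; $\mathfrak a^n$ is the $n$-fold composition (for $n=0$, $t_1\stackrel{\mathfrak a^0}\Rightarrow t_2$ is read as $t_1=t_2$). Sentences $\phi::=t_1=t_2\mid t_1\stackrel{\mathfrak a}\Rightarrow t_2\mid\neg\phi\mid\bigvee\Phi\mid\exists X\,\phi'$ (ground terms, finite $\Phi$, finite variable set $X$ added as new constants giving $\Sigma[X]$, $\phi'\in\mathrm{Sen}(\Sigma[X])$);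 $\bot:=\bigvee\emptyset$. Satisfaction: $t_1=t_2$ iff equal values; $t_1\stackrel{\mathfrak a}\Rightarrow t_2$ iff the pair of values is in $\mathfrak a^{\mathfrak A}$; $\neg$, $\bigvee$ classical; $\exists X\phi'$ iff some valuation of $X$ in $\mathfrak A$ satisfies $\phi'$. $\Gamma\models_\Sigma\phi$ iff every $\Sigma$-model of $\Gamma$ satisfies $\phi$. Substitutions $\theta\colon X\to T_\Sigma$ (ground terms) act on sentences. Dynamic entailment $\vdash$: the least family $\vdash_\Sigma\subseteq\mathcal P(\mathrm{Sen}(\Sigma))^2$ closed under Monotonicity ($\Gamma\supseteq\Phi\Rightarrow\Gamma\vdash\Phi$), Transitivity, Union, Translation along signature morphisms, and: (R) $\Gamma\vdash t=t$; (S),(T) symmetry and transitivity of $=$; (F) $\Gamma\vdash t_i=t_i'$ for all $i$ gives $\Gamma\vdash\sigma(\bar t)=\sigma(\bar t')$; (P) $\Gamma\vdash t_1=t_1'$, $\Gamma\vdash t_2=t_2'$, $\Gamma\vdash t_1\stackrel{\lambda}\Rightarrow t_2$ give $\Gamma\vdash t_1'\stackrel{\lambda}\Rightarrow t_2'$; (M) for $f\in M$, $\Gamma\vdash t_j\stackrel{\lambda}\Rightarrow u_j$ gives $\Gamma\vdash f(\dots,t_j,\dots)\stackrel{\lambda}\Rightarrow f(\dots,u_j,\dots)$; (Comp$_I$) from $t_1\stackrel{\mathfrak a_1}\Rightarrow t$ and $t\stackrel{\mathfrak a_2}\Rightarrow t_2$ infer $t_1\stackrel{\mathfrak a_1;\mathfrak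 a_2}\Rightarrow t_2$; (Comp$_E$) if $\Gamma\vdash_\Sigma t_1\stackrel{\mathfrak a_1;\mathfrak a_2}\Rightarrow t_2$ and $\Gamma\cup\{t_1\stackrel{\mathfrak a_1}\Rightarrow x,x\stackrel{\mathfrak a_2}\Rightarrow t_2\}\vdash_{\Sigma[x]}\phi$ ($x$ new constant of the sort of $t_1$, $\phi\in\mathrm{Sen}(\Sigma)$) then $\Gamma\vdash_\Sigma\phi$; (Union$_I$) from $t_1\stackrel{\mathfrak a_i}\Rightarrow t_2$ infer $t_1\stackrel{\mathfrak a_1\cup\mathfrak a_2}\Rightarrow t_2$; (Union$_E$) if $\Gamma\vdash t_1\stackrel{\mathfrak a_1\cup\mathfrak a_2}\Rightarrow t_2$ and $\Gamma\cup\{t_1\stackrel{\mathfrak a_i}\Rightarrow t_2\}\vdash\phi$ for $i=1,2$ then $\Gamma\vdash\phi$; (Star$_I$) from $t_1\stackrel{\mathfrak a^n}\Rightarrow t_2$ (some $n$) infer $t_1\stackrel{\mathfrak a^*}\Rightarrow t_2$; (Star$_E$) if $\Gamma\vdash t_1\stackrel{\mathfrak a^*}\Rightarrow t_2$ and $\Gamma\cup\{t_1\stackrel{\mathfrak a^n}\Rightarrow t_2\}\vdash\phi$ for all $n\in\omega$ then $\Gamma\vdash\phi$; (Neg$_D$) $\Gamma\vdash\neg\neg\phi$ gives $\Gamma\vdash\phi$; (False) $\Gamma\vdash\bot$ gives $\Gamma\vdash\phi$; (Neg$_I$) $\Gamma\cup\{\phi\}\vdash\bot$ gives $\Gamma\vdash\neg\phi$;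 (Neg$_E$) $\Gamma\vdash\neg\phi$ gives $\Gamma\cup\{\phi\}\vdash\bot$; (Disj$_I$) $\Gamma\vdash\phi$, $\phi\in\Phi$ give $\Gamma\vdash\bigvee\Phi$; (Disj$_E$) $\Gamma\vdash\bigvee\Phi$ and $\Gamma\cup\{\phi\}\vdash\gamma$ for all $\phi\in\Phi$ give $\Gamma\vdash\gamma$; (Quant$_I$) $\Gamma\cup\{\phi\}\vdash_{\Sigma[X]}\gamma$ gives $\Gamma\cup\{\exists X\phi\}\vdash_\Sigma\gamma$; (Quant$_E$) the converse; (Subst) $\Gamma\vdash_\Sigma\theta(\phi)$ for $\theta\colon X\to T_\Sigma$ gives $\Gamma\vdash_\Sigma\exists X\phi$. *)

(* Defs.v *)
From mathcomp Require Import all_boot.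
From mathcomp Require Import boolp classical_sets cardinality.
From Stdlib Require Import Relation_Operators.
From Stdlib Require List.

Set Implicit Arguments.
Unset Strict Implicit.
Unset Printing Implicit Defensive.

Local Open Scope classical_set_scope.

(* [pos w s] is the type of the positions of sort [s] in the word [w].  It
   serves both for argument positions of an arity and for variables: a finite
   sorted set of variables is given by the word [X] of their sorts, its
   variables of sort [s] being the elements of [pos X s]. *)
Inductive pos (S : Type) : seq S -> S -> Type :=
| PZ s w : pos (s :: w) s
| PS s s' w : pos w s -> pos (s' :: w) s.

Inductive hlist (S : Type) (D : S -> Type) : seq S -> Type :=
| hnil : hlist D [::]
| hcons s w : D s -> hlist D w -> hlist D (s :: w).

Definition hhead (S : Type) (D : S -> Type) s w (l : hlist D (s :: w)) : D s :=
  match l with hcons _ _ a _ => a end.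

Definition htail (S : Type) (D : S -> Type) s w (l : hlist D (s :: w)) :
    hlist D w :=
  match l with hcons _ _ _ l' => l' end.

Fixpoint hnth (S : Type) (D : S -> Type) w s (i : pos w s) :
    hlist D w -> D s :=
  match i with
  | PZ _ _ => fun l => hhead l
  | PS _ _ _ j => fun l => hnth j (htail l)
  end.

Fixpoint hset (S : Type) (D : S -> Type) w s (i : pos w s) :
    hlist D w -> D s -> hlist D w :=
  match i with
  | PZ _ _ => fun l a => hcons a (htail l)
  | PS _ _ _ j => fun l a => hcons (hhead l) (hset j (htail l) a)
  end.

Definition hmap (S : Type) (D E : S -> Type) (h : forall s, D s -> E s) :=
  fix hmap w (l : hlist D w) : hlist E w :=
  match l with
  | hnil => hnil E
  | hcons s w a l' => hcons (h s a) (hmap w l')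
  end.

(* As [hmap], along a translation [c] of the sorts. *)
Definition hmap_sort (S S' : Type) (c : S -> S') (D : S -> Type)
    (D' : S' -> Type) (h : forall s, D s -> D' (c s)) :=
  fix hmap_sort w (l : hlist D w) : hlist D' (map c w) :=
  match l with
  | hnil => hnil D'
  | hcons s w a l' => hcons (h s a) (hmap_sort w l')
  end.

Fixpoint pos_map (S S' : Type) (c : S -> S') w s (i : pos w s) :
    pos (map c w) (c s) :=
  match i with
  | PZ s w => PZ (c s) (map c w)
  | PS s s' w j => PS (c s') (pos_map c j)
  end.

(* [F w s] is the set of function symbols of arity [w] and sort [s]. *)
Definition symbols (S : Type) := seq S -> S -> Type.

Inductive term (S : Type) (F : symbols S) : S -> Type :=
| App w s : F w s -> hlist (term F) w -> term F s.

(* [ext F X] adds to [F] the variables of [X] as new constants. *)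
Inductive ext (S : Type) (F : symbols S) (X : seq S) : seq S -> S -> Type :=
| Old w s : F w s -> ext F X w s
| New s : pos X s -> ext F X [::] s.

Inductive action (L : Type) : Type :=
| ALab : L -> action L
| ASeq : action L -> action L -> action L
| AUnion : action L -> action L -> action L
| AStar : action L -> action L.

Inductive sen (S L : Type) (F : symbols S) : Type :=
| SEq s : term F s -> term F s -> sen L F
| STr s : action L -> term F s -> term F s -> sen L F
| SNeg : sen L F -> sen L F
| SDisj : seq (sen L F) -> sen L F
| SEx X : sen L (ext F X) -> sen L F.

Definition SBot (S L : Type) (F : symbols S) : sen L F := SDisj [::].

(* The transition along the [n]-fold composition of [a]; an equation if
   [n = 0]. *)
Definition STrPow (S L : Type) (F : symbols S) s (a : action L) (n : nat)
    (t1 t2 : term F s) : sen L F :=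
  match n with
  | 0 => SEq L t1 t2
  | m.+1 => STr (iter m (ASeq a) a) t1 t2
  end.

(* Substitutions fix the sorts and send each function symbol to a function
   symbol of the same rank or, for a constant, possibly to a ground term.  This
   covers at once the inclusion of [F] into [ext F X], the substitution of
   ground terms for the variables of [X], and their extensions below
   quantifiers. *)
Inductive simage (S : Type) (F : symbols S) : seq S -> S -> Type :=
| ToFn w s : F w s -> simage F w s
| ToTerm s : term F s -> simage F [::] s.

Definition subst (S : Type) (F F' : symbols S) :=
  forall w s, F w s -> simage F' w s.

Definition simage_app (S : Type) (F : symbols S) w s (u : simage F w s) :
    hlist (term F) w -> term F s :=
  match u with
  | ToFn _ _ f => fun ts => App f ts
  | ToTerm _ t => fun _ => t
  end.

Fixpoint term_subst (S : Type) (F F' : symbols S) (r : subst F F') s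
    (t : term F s) : term F' s :=
  match t with
  | App w s f ts => simage_app (r w s f) (hmap (term_subst r) ts)
  end.

Definition incl_subst (S : Type) (F : symbols S) (X : seq S) :
    subst F (ext F X) :=
  fun w s f => ToFn (Old X f).

Definition simage_incl (S : Type) (F : symbols S) (X : seq S) w s
    (u : simage F w s) : simage (ext F X) w s :=
  match u with
  | ToFn _ _ f => ToFn (Old X f)
  | ToTerm _ t => ToTerm (term_subst (@incl_subst _ _ X) t)
  end.

Definition ext_subst (S : Type) (F F' : symbols S) (X : seq S)
    (r : subst F F') : subst (ext F X) (ext F' X) :=
  fun w s f =>
  match f with
  | Old w s f => simage_incl X (r w s f)
  | New s x => ToFn (New F' x)
  end.

Fixpoint sen_subst (S L : Type) (F F' : symbols S) (r : subst F F')
    (phi : sen L F) : sen L F' :=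
  match phi with
  | SEq s t1 t2 => SEq L (term_subst r t1) (term_subst r t2)
  | STr s a t1 t2 => STr a (term_subst r t1) (term_subst r t2)
  | SNeg psi => SNeg (sen_subst r psi)
  | SDisj Phi => SDisj (map (sen_subst r) Phi)
  | SEx X psi => SEx (sen_subst (ext_subst (X := X) r) psi)
  end.

(* Terms and sentences over [F] seen over [ext F X]. *)
Definition term_incl (S : Type) (F : symbols S) (X : seq S) s (t : term F s) :
    term (ext F X) s :=
  term_subst (@incl_subst _ _ X) t.

Definition sen_incl (S L : Type) (F : symbols S) (X : seq S) (phi : sen L F) :
    sen L (ext F X) :=
  sen_subst (@incl_subst _ _ X) phi.

Definition inst_subst (S : Type) (F : symbols S) (X : seq S)
    (theta : forall s, pos X s -> term F s) : subst (ext F X) F :=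
  fun w s f =>
  match f with
  | Old w s f => ToFn f
  | New s x => ToTerm (theta s x)
  end.

Definition sen_inst (S L : Type) (F : symbols S) (X : seq S)
    (theta : forall s, pos X s -> term F s) (phi : sen L (ext F X)) :
    sen L F :=
  sen_subst (inst_subst theta) phi.

Record signature := Signature {
  sg_sort : Type;
  sg_fn : symbols sg_sort;
  sg_monotonic : forall w s, set (sg_fn w s);
  sg_label : Type
}.

Definition countable_signature (Sg : signature) :=
  [/\ countable [set: sg_sort Sg],
      countable [set: {ws : seq (sg_sort Sg) * sg_sort Sg & sg_fn ws.1 ws.2}] &
      countable [set: sg_label Sg]].

Definition Term (Sg : signature) := term (@sg_fn Sg).

Arguments Term : clear implicits.

Definition Sen (Sg : signature) := sen (sg_label Sg) (@sg_fn Sg).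

Definition ext_monotonic (Sg : signature) (X : seq (sg_sort Sg)) w s
    (f : ext (@sg_fn Sg) X w s) : Prop :=
  match f with
  | Old _ _ g => sg_monotonic g
  | New _ _ => False
  end.

Definition ext_sig (Sg : signature) (X : seq (sg_sort Sg)) : signature :=
  Signature (@ext_monotonic Sg X) (sg_label Sg).

Record morphism (Sg Sg' : signature) := Morphism {
  on_sort : sg_sort Sg -> sg_sort Sg';
  on_fn : forall w s, sg_fn w s -> @sg_fn Sg' (map on_sort w) (on_sort s);
  on_label : sg_label Sg -> sg_label Sg';
  on_fn_monotonic : forall w s (f : sg_fn w s), sg_monotonic f ->
    sg_monotonic (on_fn f)
}.

Fixpoint action_map (L L' : Type) (cl : L -> L') (a : action L) : action L' :=
  match a with
  | ALab l => ALab (cl l)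
  | ASeq a1 a2 => ASeq (action_map cl a1) (action_map cl a2)
  | AUnion a1 a2 => AUnion (action_map cl a1) (action_map cl a2)
  | AStar a1 => AStar (action_map cl a1)
  end.

Definition symbols_map (S S' : Type) (c : S -> S') (F : symbols S)
    (F' : symbols S') :=
  forall w s, F w s -> F' (map c w) (c s).

Fixpoint term_map (S S' : Type) (c : S -> S') (F : symbols S) (F' : symbols S')
    (cf : symbols_map c F F') s (t : term F s) : term F' (c s) :=
  match t with
  | App w s f ts => App (cf w s f) (hmap_sort (term_map cf) ts)
  end.

Definition ext_map (S S' : Type) (c : S -> S') (F : symbols S)
    (F' : symbols S') (X : seq S) (cf : symbols_map c F F') :
    symbols_map c (ext F X) (ext F' (map c X)) :=
  fun w s f =>
  match f with
  | Old w s f => Old (map c X) (cf w s f)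
  | New s x => New F' (pos_map c x)
  end.

Fixpoint sen_map (S S' L L' : Type) (c : S -> S') (cl : L -> L')
    (F : symbols S) (F' : symbols S') (cf : symbols_map c F F')
    (phi : sen L F) : sen L' F' :=
  match phi with
  | SEq s t1 t2 => SEq L' (term_map cf t1) (term_map cf t2)
  | STr s a t1 t2 =>
      STr (action_map cl a) (term_map cf t1) (term_map cf t2)
  | SNeg psi => SNeg (sen_map cl cf psi)
  | SDisj Phi => SDisj (map (sen_map cl cf) Phi)
  | SEx X psi => SEx (sen_map cl (ext_map (X := X) cf) psi)
  end.

Definition translate (Sg Sg' : signature) (chi : morphism Sg Sg')
    (phi : Sen Sg) : Sen Sg' :=
  sen_map (on_label chi) (@on_fn _ _ chi) phi.

(* Algebras with transition relations, before monotonicity is imposed. *)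
Record structure (S L : Type) (F : symbols S) := Structure {
  carrier : S -> Type;
  interp : forall w s, F w s -> hlist carrier w -> carrier s;
  trans : L -> forall s, carrier s -> carrier s -> Prop
}.

Record model (Sg : signature) := Model {
  model_structure :> structure (sg_label Sg) (@sg_fn Sg);
  model_monotone : forall w s (f : @sg_fn Sg w s), sg_monotonic f ->
    forall (l : sg_label Sg) s' (k : pos w s')
           (args : hlist (carrier model_structure) w)
           (b : carrier model_structure s'),
    trans l (hnth k args) b ->
    trans l (interp f args) (interp f (hset k args b))
}.

Fixpoint eval (S L : Type) (F : symbols S) (A : structure L F) s
    (t : term F s) : carrier A s :=
  match t with
  | App w s f ts => interp f (hmap (eval A) ts)
  end.

Fixpoint action_rel (S L : Type) (F : symbols S) (A : structure L F)
    (a : action L) s : carrier A s -> carrier A s -> Prop :=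
  match a with
  | ALab l => @trans _ _ _ A l s
  | ASeq a1 a2 => fun x y =>
      exists z, action_rel a1 x z /\ action_rel a2 z y
  | AUnion a1 a2 => fun x y => action_rel a1 x y \/ action_rel a2 x y
  | AStar a1 => clos_refl_trans (carrier A s) (@action_rel _ _ _ A a1 s)
  end.

Definition expansion (S L : Type) (F : symbols S) (X : seq S)
    (A : structure L F) (v : forall s, pos X s -> carrier A s) :
    structure L (ext F X) :=
  {| carrier := carrier A;
     interp := fun w s f =>
       match f in ext _ _ w s return hlist (carrier A) w -> carrier A s with
       | Old w s g => @interp _ _ _ A w s g
       | New s x => fun _ => v s x
       end;
     trans := @trans _ _ _ A |}.

Fixpoint sat (S L : Type) (F : symbols S) (phi : sen L F)
    (A : structure L F) : Prop :=
  match phi with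
  | SEq s t1 t2 => eval A t1 = eval A t2
  | STr s a t1 t2 => action_rel a (eval A t1) (eval A t2)
  | SNeg psi => ~ sat psi A
  | SDisj Phi => foldr (fun psi P => sat psi A \/ P) False Phi
  | SEx X psi =>
      exists v : forall s, pos X s -> carrier A s, sat psi (expansion v)
  end.

Definition consequence (Sg : signature) (G : set (Sen Sg)) (phi : Sen Sg) :=
  forall A : model Sg, (forall gamma, G gamma -> sat gamma A) -> sat phi A.

Reserved Notation "G |-- P" (at level 75, no associativity).

(* The signature is implicit: [@entails Sg G P] is entailment over [Sg]. *)
Inductive entails :
    forall Sg : signature, set (Sen Sg) -> set (Sen Sg) -> Prop :=
| Monotonicity Sg (G P : set (Sen Sg)) : P `<=` G -> G |-- P
| Transitivity Sg (G P Q : set (Sen Sg)) : G |-- P -> P |-- Q -> G |-- Q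
| Union Sg (G P : set (Sen Sg)) :
    (forall phi, P phi -> G |-- [set phi]) -> G |-- P
| Translation Sg Sg' (chi : morphism Sg Sg') (G P : set (Sen Sg)) :
    G |-- P -> translate chi @` G |-- translate chi @` P
| Rule_R Sg (G : set (Sen Sg)) s (t : Term Sg s) : G |-- [set SEq _ t t]
| Rule_S Sg (G : set (Sen Sg)) s (t1 t2 : Term Sg s) :
    G |-- [set SEq _ t1 t2] -> G |-- [set SEq _ t2 t1]
| Rule_T Sg (G : set (Sen Sg)) s (t1 t2 t3 : Term Sg s) :
    G |-- [set SEq _ t1 t2] -> G |-- [set SEq _ t2 t3] ->
    G |-- [set SEq _ t1 t3]
| Rule_F Sg (G : set (Sen Sg)) w s (f : @sg_fn Sg w s)
    (ts ts' : hlist (Term Sg) w) :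
    (forall s' (i : pos w s'), G |-- [set SEq _ (hnth i ts) (hnth i ts')]) ->
    G |-- [set SEq _ (App f ts) (App f ts')]
| Rule_P Sg (G : set (Sen Sg)) s (l : sg_label Sg) (t1 t1' t2 t2' : Term Sg s) :
    G |-- [set SEq _ t1 t1'] -> G |-- [set SEq _ t2 t2'] ->
    G |-- [set STr (ALab l) t1 t2] -> G |-- [set STr (ALab l) t1' t2']
| Rule_M Sg (G : set (Sen Sg)) w s (f : @sg_fn Sg w s) (l : sg_label Sg)
    (ts : hlist (Term Sg) w) s' (j : pos w s') (u : Term Sg s') :
    sg_monotonic f ->
    G |-- [set STr (ALab l) (hnth j ts) u] ->
    G |-- [set STr (ALab l) (App f ts) (App f (hset j ts u))]
| Comp_I Sg (G : set (Sen Sg)) s (a1 a2 : action (sg_label Sg))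
    (t1 t t2 : Term Sg s) :
    G |-- [set STr a1 t1 t] -> G |-- [set STr a2 t t2] ->
    G |-- [set STr (ASeq a1 a2) t1 t2]
| Comp_E Sg (G : set (Sen Sg)) s (a1 a2 : action (sg_label Sg))
    (t1 t2 : Term Sg s) (phi : Sen Sg) :
    G |-- [set STr (ASeq a1 a2) t1 t2] ->
    (let x : Term (ext_sig [:: s]) s :=
       App (New (@sg_fn Sg) (PZ s [::])) (hnil _) in
     @entails (ext_sig [:: s])
       (sen_incl [:: s] @` G `|`
         [set STr a1 (term_incl [:: s] t1) x;
              STr a2 x (term_incl [:: s] t2)])
       [set sen_incl [:: s] phi]) ->
    G |-- [set phi]
| Union_I1 Sg (G : set (Sen Sg)) s (a1 a2 : action (sg_label Sg))
    (t1 t2 : Term Sg s) :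
    G |-- [set STr a1 t1 t2] -> G |-- [set STr (AUnion a1 a2) t1 t2]
| Union_I2 Sg (G : set (Sen Sg)) s (a1 a2 : action (sg_label Sg))
    (t1 t2 : Term Sg s) :
    G |-- [set STr a2 t1 t2] -> G |-- [set STr (AUnion a1 a2) t1 t2]
| Union_E Sg (G : set (Sen Sg)) s (a1 a2 : action (sg_label Sg))
    (t1 t2 : Term Sg s) (phi : Sen Sg) :
    G |-- [set STr (AUnion a1 a2) t1 t2] ->
    G `|` [set STr a1 t1 t2] |-- [set phi] ->
    G `|` [set STr a2 t1 t2] |-- [set phi] ->
    G |-- [set phi]
| Star_I Sg (G : set (Sen Sg)) s (a : action (sg_label Sg)) (n : nat)
    (t1 t2 : Term Sg s) :
    G |-- [set STrPow a n t1 t2] -> G |-- [set STr (AStar a) t1 t2]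
| Star_E Sg (G : set (Sen Sg)) s (a : action (sg_label Sg))
    (t1 t2 : Term Sg s) (phi : Sen Sg) :
    G |-- [set STr (AStar a) t1 t2] ->
    (forall n : nat, G `|` [set STrPow a n t1 t2] |-- [set phi]) ->
    G |-- [set phi]
| Neg_D Sg (G : set (Sen Sg)) (phi : Sen Sg) :
    G |-- [set SNeg (SNeg phi)] -> G |-- [set phi]
| False_E Sg (G : set (Sen Sg)) (phi : Sen Sg) :
    G |-- [set SBot _ _] -> G |-- [set phi]
| Neg_I Sg (G : set (Sen Sg)) (phi : Sen Sg) :
    G `|` [set phi] |-- [set SBot _ _] -> G |-- [set SNeg phi]
| Neg_E Sg (G : set (Sen Sg)) (phi : Sen Sg) :
    G |-- [set SNeg phi] -> G `|` [set phi] |-- [set SBot _ _]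
| Disj_I Sg (G : set (Sen Sg)) (Phi : seq (Sen Sg)) (phi : Sen Sg) :
    G |-- [set phi] -> List.In phi Phi -> G |-- [set SDisj Phi]
| Disj_E Sg (G : set (Sen Sg)) (Phi : seq (Sen Sg)) (gamma : Sen Sg) :
    G |-- [set SDisj Phi] ->
    (forall phi, List.In phi Phi -> G `|` [set phi] |-- [set gamma]) ->
    G |-- [set gamma]
| Quant_I Sg (G : set (Sen Sg)) (X : seq (sg_sort Sg)) (phi : Sen (ext_sig X))
    (gamma : Sen Sg) :
    @entails (ext_sig X) (sen_incl X @` G `|` [set phi])
      [set sen_incl X gamma] ->
    G `|` [set SEx phi] |-- [set gamma]
| Quant_E Sg (G : set (Sen Sg)) (X : seq (sg_sort Sg)) (phi : Sen (ext_sig X))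
    (gamma : Sen Sg) :
    G `|` [set SEx phi] |-- [set gamma] ->
    @entails (ext_sig X) (sen_incl X @` G `|` [set phi])
      [set sen_incl X gamma]
| Subst Sg (G : set (Sen Sg)) (X : seq (sg_sort Sg)) (phi : Sen (ext_sig X))
    (theta : forall s, pos X s -> Term Sg s) :
    G |-- [set sen_inst theta phi] -> G |-- [set SEx phi]
where "G |-- P" := (entails G P).

(* Main.v *)
(** Soundness is an induction on derivations, resting on the satisfaction
    condition for substitutions and for signature morphisms.

    Completeness is a Henkin argument adapted to the infinitary rule for [*].
    Starting from [G] and the negation of [phi], consistent together, each step
    decides one sentence and, when it is accepted, adds a witness: new
    constants for [SEx] and [ASeq], an exponent for [AStar].  Constants are only
    added on demand, because naming an element of every sort would be unsound
    when carriers may be empty.  The consistency of the limit theory, which is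
    not immediate in an infinitary calculus, is not needed: truth in the term
    model only involves finitely many sentences at a time, and these already
    belong to one consistent stage. *)

Require Import Defs.
From mathcomp Require Import all_boot.
From mathcomp Require Import boolp classical_sets cardinality.
From Stdlib Require Import Relation_Operators Operators_Properties Cantor Eqdep.

Set Implicit Arguments.
Unset Strict Implicit.
Unset Printing Implicit Defensive.

Local Open Scope classical_set_scope.

(** * Heterogeneous lists *)

Lemma hlist0 (S : Type) (D : S -> Type) (l : hlist D [::]) : l = hnil D.
Proof.
exact: (match l as l' in hlist _ w return
    match w return hlist D w -> Prop with
    | [::] => fun l => l = hnil D | _ :: _ => fun=> True end l'
  with hnil => erefl | hcons _ _ _ _ => I end).
Qed.

Lemma hlist_cons (S : Type) (D : S -> Type) s w (l : hlist D (s :: w)) :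
  l = hcons (hhead l) (htail l).
Proof.
exact: (match l as l' in hlist _ w return
    match w return hlist D w -> Prop with
    | [::] => fun=> True | _ :: _ => fun l => l = hcons (hhead l) (htail l)
    end l'
  with hnil => I | hcons _ _ _ _ => erefl end).
Qed.

Lemma hmap_hnth (S : Type) (D E : S -> Type) (h : forall s, D s -> E s) w s
    (i : pos w s) (l : hlist D w) :
  hnth i (hmap h l) = h s (hnth i l).
Proof.
elim: i l => [{}s {}w|{}s s' {}w i IH] l; rewrite (hlist_cons l) //=.
Qed.

Lemma hmap_hset (S : Type) (D E : S -> Type) (h : forall s, D s -> E s) w s
    (i : pos w s) (l : hlist D w) a :
  hmap h (hset i l a) = hset i (hmap h l) (h s a).
Proof.
elim: i l a => [{}s {}w|{}s s' {}w i IH] l a; rewrite (hlist_cons l) //=.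
by rewrite IH.
Qed.

Lemma hmap_comp (S : Type) (D E H : S -> Type) (h : forall s, D s -> E s)
    (g : forall s, E s -> H s) w (l : hlist D w) :
  hmap g (hmap h l) = hmap (fun s x => g s (h s x)) l.
Proof. by elim: l => //= s {}w a l ->. Qed.

Lemma hmap_id (S : Type) (D : S -> Type) w (l : hlist D w) :
  hmap (fun s x => x) l = l.
Proof. by elim: l => //= s {}w a l ->. Qed.

(** Isolates the pure reindexing of sorts, which is how [map_reduct] passes arguments to a
    translated symbol. *)
Lemma hmap_sortE (S S' : Type) (c : S -> S') (D : S -> Type)
    (D' : S' -> Type) (h : forall s, D s -> D' (c s)) w (l : hlist D w) :
  hmap_sort h l = hmap_sort (c := c) (fun s x => x) (hmap h l).
Proof. by elim: l => //= s {}w a l ->. Qed.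

Lemma hmap_hmap_sort (S S' : Type) (c : S -> S') (D : S -> Type)
    (D' E' : S' -> Type) (h : forall s, D s -> D' (c s))
    (g : forall s, D' s -> E' s) w (l : hlist D w) :
  hmap g (hmap_sort h l) = hmap_sort (fun s x => g (c s) (h s x)) l.
Proof. by elim: l => //= s {}w a l ->. Qed.

Lemma hnth_hmap_sort (S S' : Type) (c : S -> S') (D : S -> Type)
    (D' : S' -> Type) (h : forall s, D s -> D' (c s)) w s (i : pos w s)
    (l : hlist D w) :
  hnth (pos_map c i) (hmap_sort h l) = h s (hnth i l).
Proof.
elim: i l => [{}s {}w|{}s s' {}w i IH] l; rewrite (hlist_cons l) //=.
Qed.

Lemma hset_hmap_sort (S S' : Type) (c : S -> S') (D : S -> Type)
    (D' : S' -> Type) (h : forall s, D s -> D' (c s)) w s (i : pos w s)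
    (l : hlist D w) a :
  hmap_sort h (hset i l a) = hset (pos_map c i) (hmap_sort h l) (h s a).
Proof.
elim: i l a => [{}s {}w|{}s s' {}w i IH] l a; rewrite (hlist_cons l) //=.
by rewrite IH.
Qed.

(** As a list, a valuation of finitely many variables can be handled by induction or mapped along a
    translation of sorts. *)
Lemma hlist_of_fun (S : Type) (D : S -> Type) w
    (v : forall s, pos w s -> D s) :
  exists l : hlist D w, forall s (i : pos w s), hnth i l = v s i.
Proof.
elim: w v => [|s w IH] v.
  by exists (hnil D) => s i; inversion i.
have [l lP] := IH (fun s' i => v s' (PS s i)).
exists (hcons (v s (PZ s w)) l) => s' i.
move: lP.
(* [v] and [l] depend on the word, so they are generalised together with the position in the return
   type. *)
refine (match i as i' in pos w' s0 return
  match w' return pos w' s0 -> Prop with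
  | [::] => fun=> True
  | s1 :: w1 => fun i => forall (v : forall s, pos (s1 :: w1) s -> D s) l,
     (forall s i, hnth i l = v s (PS s1 i)) ->
     hnth i (hcons (v s1 (PZ s1 w1)) l) = v s0 i
  end i' with PZ _ _ => _ | PS _ _ _ _ => _ end v l).
  by [].
by move=> v' l' /= ->.
Qed.

(** * Induction principles *)

(** Carries the induction hypotheses on the arguments of a term: terms are nested in [hlist], and
    the generated principle provides none. *)
Fixpoint hall (S : Type) (D : S -> Type) (P : forall s, D s -> Prop) w
    (l : hlist D w) : Prop :=
  match l with
  | hnil => True
  | hcons s w a l' => P s a /\ hall P l'
  end.

Lemma hmap_ext_hall (S : Type) (D E : S -> Type) (h g : forall s, D s -> E s) w
    (l : hlist D w) :
  hall (fun s x => h s x = g s x) l -> hmap h l = hmap g l.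
Proof. by elim: l => //= s {}w a l IH [-> /IH ->]. Qed.

Lemma term_hall_ind (S : Type) (F : symbols S)
    (P : forall s, term F s -> Prop) :
  (forall w s (f : F w s) ts, hall P ts -> P s (App f ts)) ->
  forall s t, P s t.
Proof.
move=> H; fix IH 2 => s [w {}s f ts]; apply: H.
by elim: ts => //= s' w' t ts IHts; split.
Qed.

Lemma sen_In_ind (S L : Type) (P : forall F : symbols S, sen L F -> Prop) :
  (forall F s (t1 t2 : term F s), P F (SEq L t1 t2)) ->
  (forall F s (a : action L) (t1 t2 : term F s), P F (STr a t1 t2)) ->
  (forall F phi, P F phi -> P F (SNeg phi)) ->
  (forall F Phi, (forall phi, List.In phi Phi -> P F phi) -> P F (SDisj Phi)) ->
  (forall F X (phi : sen L (ext F X)), P (ext F X) phi -> P F (SEx phi)) ->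
  forall F phi, P F phi.
Proof.
move=> HEq HTr HNeg HDisj HEx; fix IH 2 => F [s t1 t2|s a t1 t2|phi|Phi|X phi].
- exact: HEq.
- exact: HTr.
- exact/HNeg/IH.
- apply: HDisj; elim: Phi => [psi []|phi Phi IHPhi psi /= [<-|]].
    exact: IH.
  exact: IHPhi.
- exact/HEx/IH.
Qed.

(** * Satisfaction under substitutions and signature morphisms *)

Definition simage_interp (S L : Type) (F : symbols S) (A : structure L F) w s
    (u : simage F w s) : hlist (carrier A) w -> carrier A s :=
  match u with
  | ToFn _ _ f => fun args => interp f args
  | ToTerm _ t => fun _ => eval A t
  end.

Definition subst_reduct (S L : Type) (F F' : symbols S) (r : subst F F')
    (A : structure L F') : structure L F :=
  {| carrier := carrier A;
     interp := fun w s f => simage_interp (A := A) (r w s f);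
     trans := @trans _ _ _ A |}.

Lemma eval_subst (S L : Type) (F F' : symbols S) (r : subst F F')
    (A : structure L F') s (t : term F s) :
  eval A (term_subst r t) = eval (subst_reduct r A) t.
Proof.
elim/term_hall_ind: t => w {}s f ts /hmap_ext_hall IH /=.
by case: (r w s f) ts IH => //= w' s' g ts; rewrite hmap_comp => ->.
Qed.

Lemma eval_incl (S L : Type) (F : symbols S) (A : structure L F) X
    (v : forall s, pos X s -> carrier A s) s (t : term F s) :
  eval (expansion v) (term_incl X t) = eval A t.
Proof.
rewrite /term_incl eval_subst.
(* Once [A] is a constructor, its expansion reduces back to [A] by computation. *)
by case: A v.
Qed.

Lemma action_rel_subst (S L : Type) (F F' : symbols S) (r : subst F F')
    (A : structure L F') (a : action L) s :
  @action_rel _ _ _ A a s = @action_rel _ _ _ (subst_reduct r A) a s.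
Proof.
by elim: a => [l|a1 IH1 a2 IH2|a1 IH1 a2 IH2|a IH] //=; rewrite ?IH1 ?IH2 ?IH.
Qed.

(** The quantifier case of the satisfaction condition. Only a constant sent to a term needs an
    argument: its value does not see the new variables. *)
Lemma subst_reduct_expansion (S L : Type) (F F' : symbols S) (r : subst F F')
    (A : structure L F') X (v : forall s, pos X s -> carrier A s) :
  subst_reduct (ext_subst (X := X) r) (expansion v) =
  expansion (A := subst_reduct r A) v.
Proof.
congr (Structure _ (@trans _ _ _ A)).
apply/functional_extensionality_dep => w.
apply/functional_extensionality_dep => s.
apply/functional_extensionality_dep => -[].
  move=> {}w {}s f; apply/funext => args /=.
  by case: (r w s f) args => //= s' t _; exact: eval_incl.
by [].
Qed.

Lemma sat_subst (S L : Type) (F F' : symbols S) (r : subst F F')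
    (phi : sen L F) (A : structure L F') :
  sat (sen_subst r phi) A <-> sat phi (subst_reduct r A).
Proof.
elim/sen_In_ind: phi F' r A => {}F.
- by move=> s t1 t2 F' r A /=; rewrite !eval_subst.
- by move=> s a t1 t2 F' r A /=; rewrite !eval_subst (action_rel_subst r).
- by move=> phi IH F' r A /=; rewrite IH.
- move=> Phi IH F' r A /=; elim: Phi IH => //= phi Phi IHPhi IH.
  have {}IHPhi := IHPhi (fun psi h => IH psi (or_intror h)).
  by rewrite (IH phi (or_introl erefl)) IHPhi.
- move=> X phi IH F' r A /=; split=> -[v].
    by rewrite IH subst_reduct_expansion => h; exists v.
  by move=> h; exists v; rewrite IH subst_reduct_expansion.
Qed.

Definition map_reduct (S S' L L' : Type) (c : S -> S') (cl : L -> L')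
    (F : symbols S) (F' : symbols S') (cf : symbols_map c F F')
    (A : structure L' F') : structure L F :=
  {| carrier := fun s => carrier A (c s);
     interp := fun w s f args =>
       interp (cf w s f) (hmap_sort (c := c) (fun s x => x) args);
     trans := fun l s => @trans _ _ _ A (cl l) (c s) |}.

Lemma eval_map (S S' L L' : Type) (c : S -> S') (cl : L -> L')
    (F : symbols S) (F' : symbols S') (cf : symbols_map c F F')
    (A : structure L' F') s (t : term F s) :
  eval A (term_map cf t) = eval (map_reduct cl cf A) t.
Proof.
elim/term_hall_ind: t => w {}s f ts /hmap_ext_hall IH /=.
by rewrite -IH hmap_hmap_sort -hmap_sortE.
Qed.

Lemma action_rel_map (S S' L L' : Type) (c : S -> S') (cl : L -> L')
    (F : symbols S) (F' : symbols S') (cf : symbols_map c F F')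
    (A : structure L' F') (a : action L) s :
  @action_rel _ _ _ A (action_map cl a) (c s) =
  @action_rel _ _ _ (map_reduct cl cf A) a s.
Proof.
by elim: a => [l|a1 IH1 a2 IH2|a1 IH1 a2 IH2|a IH] //=; rewrite ?IH1 ?IH2 ?IH.
Qed.

Lemma map_reduct_expansion (S S' L L' : Type) (c : S -> S') (cl : L -> L')
    (F : symbols S) (F' : symbols S') (cf : symbols_map c F F')
    (A : structure L' F') X (v : forall s, pos (map c X) s -> carrier A s) :
  map_reduct cl (ext_map (X := X) cf) (expansion v) =
  expansion (A := map_reduct cl cf A) (fun s x => v (c s) (pos_map c x)).
Proof.
congr Structure.
apply/functional_extensionality_dep => w.
apply/functional_extensionality_dep => s.
by apply/functional_extensionality_dep => -[].
Qed.

(** Variables are positions, so those of [X] and of [map c X] correspond one to one even when [c]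
    identifies sorts. Hence no valuation is lost by translation. *)
Lemma valuation_map (S S' : Type) (c : S -> S') (D : S' -> Type) X
    (v : forall s, pos X s -> D (c s)) :
  exists v' : forall s, pos (map c X) s -> D s,
    v = fun s x => v' (c s) (pos_map c x).
Proof.
have [l lP] := hlist_of_fun v.
exists (fun s x => hnth x (hmap_sort (c := c) (fun s x => x) l)).
apply/functional_extensionality_dep => s; apply/funext => x.
by rewrite hnth_hmap_sort lP.
Qed.

Lemma sat_map (S S' L L' : Type) (c : S -> S') (cl : L -> L')
    (F : symbols S) (F' : symbols S') (cf : symbols_map c F F')
    (phi : sen L F) (A : structure L' F') :
  sat (sen_map cl cf phi) A <-> sat phi (map_reduct cl cf A).
Proof.
elim/sen_In_ind: phi F' cf A => {}F.
- by move=> s t1 t2 F' cf A /=; rewrite !(eval_map cl).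
- by move=> s a t1 t2 F' cf A /=; rewrite !(eval_map cl) (action_rel_map cl cf).
- by move=> phi IH F' cf A /=; rewrite IH.
- move=> Phi IH F' cf A /=; elim: Phi IH => //= phi Phi IHPhi IH.
  have {}IHPhi := IHPhi (fun psi h => IH psi (or_intror h)).
  by rewrite (IH phi (or_introl erefl)) IHPhi.
- move=> X phi IH F' cf A /=; split=> -[v].
    by rewrite IH map_reduct_expansion => h; eexists; exact: h.
  have [v' ->] := valuation_map v => h.
  by exists v'; rewrite IH map_reduct_expansion.
Qed.

(** * Soundness *)

Lemma morphism_reduct_monotone (Sg Sg' : signature) (chi : morphism Sg Sg')
    (A : model Sg') : let B := map_reduct (on_label chi) (@on_fn _ _ chi) A in
  forall w s (f : @sg_fn Sg w s), sg_monotonic f ->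
    forall (l : sg_label Sg) s' (k : pos w s') (args : hlist (carrier B) w)
      (b : carrier B s'),
    trans l (hnth k args) b ->
    trans l (interp f args) (interp f (hset k args b)).
Proof.
move=> /= w s f fM l s' k args b h.
have := @model_monotone _ A _ _ _ (on_fn_monotonic chi fM) (on_label chi l) _
  (pos_map _ k) (hmap_sort (c := on_sort chi) (fun s x => x) args) b.
by rewrite hnth_hmap_sort hset_hmap_sort; exact.
Qed.

Definition morphism_reduct (Sg Sg' : signature) (chi : morphism Sg Sg')
    (A : model Sg') : model Sg :=
  Model (@morphism_reduct_monotone Sg Sg' chi A).

Lemma expansion_monotone (Sg : signature) (A : model Sg)
    (X : seq (sg_sort Sg)) (v : forall s, pos X s -> carrier A s) :
  forall w s (f : ext (@sg_fn Sg) X w s), ext_monotonic f ->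
    forall (l : sg_label Sg) s' (k : pos w s') (args : hlist (carrier A) w)
      (b : carrier A s'),
    trans l (hnth k args) b ->
    @trans _ _ _ A l _ (@interp _ _ _ (expansion v) _ _ f args)
      (@interp _ _ _ (expansion v) _ _ f (hset k args b)).
Proof. by move=> w s [] //= {}w {}s f; exact: model_monotone. Qed.

Definition expansion_model (Sg : signature) (A : model Sg)
    (X : seq (sg_sort Sg)) (v : forall s, pos X s -> carrier A s) :
    model (ext_sig X) :=
  @Model (ext_sig X) (expansion v) (@expansion_monotone Sg A X v).

Lemma subst_reduct_incl_expansion (S L : Type) (F : symbols S)
    (A : structure L F) X (v : forall s, pos X s -> carrier A s) :
  subst_reduct (@incl_subst _ F X) (expansion v) = A.
Proof. by case: A v. Qed.

Lemma sat_incl (S L : Type) (F : symbols S) (A : structure L F) X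
    (v : forall s, pos X s -> carrier A s) (phi : sen L F) :
  sat (sen_incl X phi) (expansion v) <-> sat phi A.
Proof. by rewrite /sen_incl sat_subst subst_reduct_incl_expansion. Qed.

Lemma action_rel_expansion (S L : Type) (F : symbols S) (A : structure L F) X
    (v : forall s, pos X s -> carrier A s) (a : action L) s :
  @action_rel _ _ _ (expansion v) a s = @action_rel _ _ _ A a s.
Proof.
by elim: a => [l|a1 IH1 a2 IH2|a1 IH1 a2 IH2|a IH] //=; rewrite ?IH1 ?IH2 ?IH.
Qed.

Lemma subst_reduct_inst (S L : Type) (F : symbols S) (A : structure L F) X
    (theta : forall s, pos X s -> term F s) :
  subst_reduct (inst_subst theta) A =
  expansion (A := A) (fun s x => eval A (theta s x)).
Proof.
congr Structure.
apply/functional_extensionality_dep => w.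
apply/functional_extensionality_dep => s.
by apply/functional_extensionality_dep => -[].
Qed.

Lemma sat_disj (S L : Type) (F : symbols S) (A : structure L F) Phi :
  sat (SDisj Phi) A <-> exists2 phi : sen L F, List.In phi Phi & sat phi A.
Proof.
rewrite /=; elim: Phi => [|phi Phi IH] /=; first by split=> // -[].
rewrite IH.
split=> [[h|[psi ? ?]]|[psi [->|?] h]].
- by exists phi; [left|].
- by exists psi; [right|].
- by left.
- by right; exists psi.
Qed.

(** [iter n (ASeq a) a] has [n + 1] factors, so the path of length zero is split off as an equality,
    as in [STrPow]. *)
Lemma action_rel_star (S L : Type) (F : symbols S) (A : structure L F)
    (a : action L) s (x y : carrier A s) :
  action_rel (AStar a) x y <->
  x = y \/ exists n, action_rel (iter n (ASeq a) a) x y.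
Proof.
split=> [h|[->|[n]]].
- elim: {h}(clos_rt_rt1n _ _ _ _ h) => [{}x|{}x z {}y xz _ [<-|[n zy]]].
    by left.
    by right; exists 0.
  by right; exists n.+1; exists z.
- exact: rt_refl.
- elim: n x => [x xy|n IH x [z [xz /IH zy]]]; first exact: rt_step.
  exact: rt_trans (rt_step _ _ _ _ xz) zy.
Qed.

Lemma sat_STrPow (S L : Type) (F : symbols S) (A : structure L F) s
    (a : action L) (t1 t2 : term F s) :
  sat (STr (AStar a) t1 t2) A <-> exists n, sat (STrPow a n t1 t2) A.
Proof.
change (action_rel (AStar a) (eval A t1) (eval A t2) <->
  exists n, sat (STrPow a n t1 t2) A).
rewrite action_rel_star.
split=> [[e|[n h]]|[[|n] h]]; first by exists 0.
- by exists n.+1.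
- by left.
- by right; exists n.
Qed.

Lemma incl_reduct_monotone (Sg : signature) (X : seq (sg_sort Sg))
    (A : model (ext_sig X)) :
  let B := subst_reduct (@incl_subst _ (@sg_fn Sg) X) A in
  forall w s (f : @sg_fn Sg w s), sg_monotonic f ->
    forall (l : sg_label Sg) s' (k : pos w s') (args : hlist (carrier B) w)
      (b : carrier B s'),
    trans l (hnth k args) b ->
    trans l (interp f args) (interp f (hset k args b)).
Proof.
move=> B w s f fM l s' k args b.
exact: (@model_monotone _ A w s (Old X f)).
Qed.

Definition incl_reduct (Sg : signature) (X : seq (sg_sort Sg))
    (A : model (ext_sig X)) : model Sg :=
  Model (@incl_reduct_monotone Sg X A).

(** The valuation reads off the values of the new constants, whose argument list can only be empty.
    It serves the soundness of [Quant_E]. *)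
Lemma expansion_incl_reduct (S L : Type) (F : symbols S) X
    (A : structure L (ext F X)) :
  exists v, A = expansion (A := subst_reduct (@incl_subst _ F X) A) (X := X) v.
Proof.
case: A => C I R; exists (fun s x => I _ _ (New F x) (hnil _)).
congr Structure.
apply/functional_extensionality_dep => w.
apply/functional_extensionality_dep => s.
apply/functional_extensionality_dep => -[] // s' x.
by apply/funext => args; rewrite (hlist0 args).
Qed.

Lemma soundness (Sg : signature) (G P : set (Sen Sg)) : entails G P ->
  forall A : model Sg, (forall gamma, G gamma -> sat gamma A) ->
  forall phi, P phi -> sat phi A.
Proof.
elim=> {G P} {}Sg.
- by move=> G P PG A AG phi /PG; exact: AG.
- by move=> G P Q _ IH1 _ IH2 A /IH1; exact: IH2.
- by move=> G P _ IH A AG phi Pphi; exact: (IH phi Pphi A AG phi).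
- move=> Sg' chi G P _ IH A AG _ [phi Pphi <-].
  rewrite /translate sat_map; apply: (IH (morphism_reduct chi A)) Pphi.
  by move=> gamma Ggamma; rewrite -sat_map; apply: AG; exists gamma.
- by move=> G s t A _ _ ->.
- by move=> G s t1 t2 _ IH A /IH/(_ _ erefl) h _ -> /=.
- move=> G s t1 t2 t3 _ IH1 _ IH2 A AG _ -> /=.
  exact: etrans (IH1 A AG _ erefl) (IH2 A AG _ erefl).
- move=> G w s f ts ts' _ IH A AG _ -> /=; congr interp.
  have {}IH s' (i : pos w s') : eval A (hnth i ts) = eval A (hnth i ts').
    exact: (IH s' i A AG _ erefl).
  elim: w ts ts' IH {f} => [|s1 w IHw] ts ts' IH.
    by rewrite (hlist0 ts) (hlist0 ts').
  rewrite (hlist_cons ts) (hlist_cons ts') /=; congr hcons.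
    exact: IH (PZ _ _).
  by apply: IHw => s' i; exact: IH (PS _ i).
- move=> G s l t1 t1' t2 t2' _ IH1 _ IH2 _ IH3 A AG _ -> /=.
  rewrite -[eval A t1'](IH1 A AG _ erefl) -[eval A t2'](IH2 A AG _ erefl).
  exact: (IH3 A AG _ erefl).
- move=> G w s f l ts s' j u fM _ IH A AG _ -> /=.
  rewrite hmap_hset; apply: model_monotone => //.
  by rewrite hmap_hnth; exact: (IH A AG _ erefl).
- move=> G s a1 a2 t1 t t2 _ IH1 _ IH2 A AG _ -> /=.
  exists (eval A t); split; first exact: (IH1 A AG _ erefl).
  exact: (IH2 A AG _ erefl).
- move=> G s a1 a2 t1 t2 phi _ IH1 _ IH2 A AG _ ->.
  have /= [z [z1 z2]] := IH1 A AG _ erefl.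
  (* The fresh constant of [Comp_E] is interpreted by the intermediate point [z]. *)
  have [v v0] : exists v : forall s', pos [:: s] s' -> carrier A s',
      v s (PZ s [::]) = z.
    exists (fun s' i => hnth i (hcons z (hnil _))); by [].
  rewrite -(sat_incl v); apply: (IH2 (@expansion_model Sg A _ v)); last by [].
  move=> gamma [[{}gamma Ggamma <-]|[->|->]].
  + by rewrite sat_incl; exact: AG.
  + by rewrite -(eval_incl v t1) -v0 -(action_rel_expansion v) in z1.
  + by rewrite -(eval_incl v t2) -v0 -(action_rel_expansion v) in z2.
- by move=> G s a1 a2 t1 t2 _ IH A AG _ ->; left; exact: (IH A AG _ erefl).
- by move=> G s a1 a2 t1 t2 _ IH A AG _ ->; right; exact: (IH A AG _ erefl).
- move=> G s a1 a2 t1 t2 phi _ IH _ IH1 _ IH2 A AG _ ->.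
  have [h|h] : sat (STr a1 t1 t2) A \/ sat (STr a2 t1 t2) A.
  + exact: (IH A AG _ erefl).
  + by apply: (IH1 A) => // gamma [/AG|->].
  + by apply: (IH2 A) => // gamma [/AG|->].
- move=> G s a n t1 t2 _ IH A AG _ ->; rewrite sat_STrPow.
  by exists n; exact: (IH A AG _ erefl).
- move=> G s a t1 t2 phi _ IH1 _ IH2 A AG _ ->.
  have /sat_STrPow[n h] := IH1 A AG _ erefl.
  by apply: (IH2 n A) => // gamma [/AG|->].
- by move=> G phi _ IH A AG _ ->; apply: contrapT; exact: (IH A AG _ erefl).
- by move=> G phi _ IH A AG; have := IH A AG _ erefl.
- move=> G phi _ IH A AG _ -> h.
  by apply: (IH A _ _ erefl) => gamma [/AG|->].
- move=> G phi _ IH A AG _ ->; apply: (IH A _ _ erefl).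
    by move=> gamma ?; apply: AG; left.
  by apply: AG; right.
- move=> G Phi phi _ IH Phi_phi A AG _ ->; apply/sat_disj; exists phi => //.
  exact: (IH A AG _ erefl).
- move=> G Phi gamma _ IH1 _ IH2 A AG _ ->.
  have /sat_disj[phi Phi_phi h] := IH1 A AG _ erefl.
  by apply: (IH2 phi Phi_phi A) => // psi [/AG|->].
- move=> G X phi gamma _ IH A AG _ ->.
  have [v h] : exists v : forall s : sg_sort Sg, pos X s -> carrier A s,
      sat phi (expansion v) by apply: (AG (SEx phi)); right.
  rewrite -(sat_incl v); apply: (IH (@expansion_model Sg A _ v)); last by [].
  move=> psi [[{}psi Gpsi <-]|->//].
  by rewrite sat_incl; apply: AG; left.
- move=> G X phi gamma _ IH A AG _ ->.
  have [v Av] := expansion_incl_reduct A.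
  have sat_inclE psi : sat (sen_incl X psi) A <-> sat psi (incl_reduct A).
    by rewrite {1}Av sat_incl.
  rewrite sat_inclE; apply: (IH (incl_reduct A)); last by [].
  move=> psi [Gpsi|->].
    by rewrite -sat_inclE; apply: AG; left; exists psi.
  by exists v; rewrite -Av; apply: AG; right.
- move=> G X phi theta _ IH A AG _ ->.
  exists (fun s x => eval A (theta s x)).
  by rewrite -subst_reduct_inst -sat_subst; exact: (IH A AG _ erefl).
Qed.

(** * Countability of the set of sentences *)

Local Notation code := (GenTree.tree nat).

Definition countable_symbols (S : Type) (F : symbols S) :=
  countable [set: {ws : seq S * S & F ws.1 ws.2}].

Lemma countable_injection (T : Type) :
  countable [set: T] -> exists c : T -> nat, injective c.
Proof.
move=> /countable_injP[c cI]; exists c => x y.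
by apply: cI; rewrite inE.
Qed.

Lemma injection_countable (T : Type) (U : countType) (c : T -> U) :
  injective c -> countable [set: T].
Proof.
move=> cI; apply/countable_injP; exists (pickle \o c) => x y _ _ /=.
by move/(pcan_inj pickleK)/cI.
Qed.

Section SyntaxCodes.
Context (S L : Type).
Implicit Types F : symbols S.

Definition symbols_code F := forall w s, F w s -> nat.

(** Injectivity across ranks: the code of a symbol must also determine its arity and sort, hence the
    dependent pairs. *)
Definition symbols_code_inj F (c : symbols_code F) :=
  forall w s (f : F w s) w' s' (f' : F w' s'), c w s f = c w' s' f' ->
  existT (fun ws => F ws.1 ws.2) (w, s) f = existT _ (w', s') f'.

Fixpoint pos_code w (s : S) (i : pos w s) : nat :=
  match i with
  | PZ _ _ => 0
  | PS _ _ _ j => (pos_code j).+1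
  end.

Lemma pos_code_inj w s (i : pos w s) s' (j : pos w s') :
  pos_code i = pos_code j -> existT (pos w) s i = existT (pos w) s' j.
Proof.
elim: i s' j => [{}s {}w|{}s s1 {}w i IH] s' j.
  refine (match j as j' in pos w' s' return
    match w' return pos w' s' -> Prop with
    | [::] => fun=> True
    | s1 :: w1 => fun j => 0 = pos_code j ->
        existT (pos (s1 :: w1)) s1 (PZ s1 w1) = existT _ s' j
    end j' with PZ _ _ => _ | PS _ _ _ _ => _ end) => //.
move: IH.
refine (match j as j' in pos w' s' return
  match w' return pos w' s' -> Prop with
  | [::] => fun=> True
  | s1 :: w1 => fun j => forall i : pos w1 s,
     (forall s' (j : pos w1 s'), pos_code i = pos_code j ->
       existT (pos w1) s i = existT (pos w1) s' j) ->
      (pos_code i).+1 = pos_code j ->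
      existT (pos (s1 :: w1)) s (PS s1 i) = existT _ s' j
  end j' with PZ _ _ => _ | PS _ _ _ _ => _ end i) => //= {}i IH [/IH].
exact: (congr1 (fun x => existT _ (projT1 x) (PS _ (projT2 x)))).
Qed.

(** Parity separates old symbols from new variables, which lets the coding be extended below each
    quantifier. *)
Definition ext_code F X (c : symbols_code F) : symbols_code (ext F X) :=
  fun w s f =>
  match f with
  | Old w s g => (c w s g).*2
  | New s x => (pos_code x).*2.+1
  end.

Lemma ext_code_inj F X (c : symbols_code F) :
  symbols_code_inj c -> symbols_code_inj (ext_code (X := X) c).
Proof.
move=> cI _ _ [w s f|s x] _ _ [w' s' f'|s' x'] /= e.
- have /cI : c w s f = c w' s' f' by apply: double_inj.
  exact: (congr1 (fun x : {ws : seq S * S & F ws.1 ws.2} =>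
    existT (fun ws => ext F X ws.1 ws.2) ((projT1 x).1, (projT1 x).2)
      (Old X (projT2 x)))).
- by have := congr1 odd e; rewrite /= !odd_double.
- by have := congr1 odd e; rewrite /= !odd_double.
- have /pos_code_inj : pos_code x = pos_code x' by apply: double_inj; case: e.
  exact: (congr1 (fun x : {s : S & pos X s} =>
    existT (fun ws => ext F X ws.1 ws.2) ([::], projT1 x) (New F (projT2 x)))).
Qed.

Definition hcodes (D : S -> Type) (h : forall s, D s -> code) :=
  fix hcodes w (l : hlist D w) : seq code :=
  match l with
  | hnil => [::]
  | hcons s w a l' => h s a :: hcodes w l'
  end.

Fixpoint term_code F (c : symbols_code F) s (t : term F s) : code :=
  match t with
  | App w s f ts => GenTree.Node (c w s f) (hcodes (term_code c) ts)
  end.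

Lemma term_code_inj F (c : symbols_code F) : symbols_code_inj c ->
  forall s (t : term F s) s' (t' : term F s'),
  term_code c t = term_code c t' -> existT (term F) s t = existT _ s' t'.
Proof.
move=> cI s t; elim/term_hall_ind: t => w {}s f ts IH _ [w' s' f' ts'] [/cI].
(* The equality of dependent pairs replaces rank and symbol at once; afterwards both argument lists
   have the same type. *)
refine (fun e => match e in _ = y return
  forall ts' : hlist (term F) (projT1 y).1,
    hcodes (term_code c) ts = hcodes (term_code c) ts' ->
    existT (term F) s (App f ts) =
    existT (term F) (projT1 y).2 (App (projT2 y) ts')
  with erefl => _ end ts') => /= {f' e ts' w' s'} ts' e.
congr (existT _ s (App f _)).
elim: ts IH ts' e {f} => [_|s1 w1 t ts IHts [IHt /IHts{}IHts]] ts'.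
  by rewrite (hlist0 ts').
rewrite (hlist_cons ts') /= => -[/IHt e1 /IHts e2].
by rewrite (inj_pair2 _ _ _ _ _ e1) e2.
Qed.

Fixpoint action_code (cl : L -> nat) (a : action L) : code :=
  match a with
  | ALab l => GenTree.Leaf (cl l)
  | ASeq a1 a2 => GenTree.Node 0 [:: action_code cl a1; action_code cl a2]
  | AUnion a1 a2 => GenTree.Node 1 [:: action_code cl a1; action_code cl a2]
  | AStar a1 => GenTree.Node 2 [:: action_code cl a1]
  end.

Lemma action_code_inj cl : injective cl -> injective (action_code cl).
Proof.
move=> clI; elim=> [l|a1 IH1 a2 IH2|a1 IH1 a2 IH2|a IH].
- by case=> //= l' [/clI ->].
- by case=> //= b1 b2 [/IH1 -> /IH2 ->].
- by case=> //= b1 b2 [/IH1 -> /IH2 ->].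
- by case=> //= b [/IH ->].
Qed.

Fixpoint sen_code (cs : S -> nat) (cl : L -> nat) F (c : symbols_code F)
    (phi : sen L F) : code :=
  match phi with
  | SEq s t1 t2 => GenTree.Node 0 [:: term_code c t1; term_code c t2]
  | STr s a t1 t2 =>
      GenTree.Node 1 [:: action_code cl a; term_code c t1; term_code c t2]
  | SNeg psi => GenTree.Node 2 [:: sen_code cs cl c psi]
  | SDisj Phi => GenTree.Node 3 (map (sen_code cs cl c) Phi)
  | SEx X psi =>
      GenTree.Node 4 [:: GenTree.Node 0 (map (@GenTree.Leaf nat \o cs) X);
        sen_code cs cl (ext_code (X := X) c) psi]
  end.

Lemma sen_code_inj cs cl F (c : symbols_code F) : injective cs ->
  injective cl -> symbols_code_inj c -> injective (sen_code cs cl c).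
Proof.
move=> csI clI cI phi; elim/sen_In_ind: phi c cI => {}F.
- move=> s t1 t2 c cI [] //= s' t1' t2' [/(term_code_inj cI) e].
  refine (match e in _ = y return forall u : term F (projT1 y),
    term_code c t2 = term_code c u -> SEq L t1 t2 = SEq L (projT2 y) u
    with erefl => _ end t2') => /= u.
  by move=> /(term_code_inj cI) e2; rewrite (inj_pair2 _ _ _ _ _ e2).
- move=> s a t1 t2 c cI [] //= s' a' t1' t2' [].
  move=> /(action_code_inj clI) <- /(term_code_inj cI) e.
  refine (match e in _ = y return forall u : term F (projT1 y),
    term_code c t2 = term_code c u -> STr a t1 t2 = STr a (projT2 y) u
    with erefl => _ end t2') => /= u.
  by move=> /(term_code_inj cI) e2; rewrite (inj_pair2 _ _ _ _ _ e2).
- by move=> phi IH c cI [] //= psi [/(IH c cI) ->].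
- move=> Phi IH c cI [] //= Psi [e]; congr SDisj.
  elim: Phi Psi IH e => [|phi Phi IHPhi] [|psi Psi] //= IH [e1 e2].
  congr cons; first by apply: (IH phi _ c cI) e1; left.
  by apply: IHPhi e2 => chi ?; apply: IH; right.
- move=> X phi IH c cI [] //= Y psi [].
  (* The two bodies are sentences over the same symbols only after the words of bound sorts have
     been identified. *)
  move=> /(inj_map (inj_comp _ csI)) e; case: _ / (e _) psi.
    by move=> ? ? [].
  by move=> psi /IH ->//; exact: ext_code_inj.
Qed.

End SyntaxCodes.

Lemma countable_symbols_ext (S : Type) (F : symbols S) X :
  countable_symbols F -> countable_symbols (ext F X).
Proof.
move=> /countable_injection[c cI].
have cI' : symbols_code_inj (fun w s (f : F w s) => c (existT _ (w, s) f)).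
  by move=> w s f w' s' f' /cI.
apply: (injection_countable (U := nat)
  (c := fun x => ext_code (X := X)
    (fun w s (f : F w s) => c (existT _ (w, s) f)) (projT2 x))).
by move=> [[w s] f] [[w' s'] f'] /(ext_code_inj cI').
Qed.

(** The enumeration inverts the injective coding, with [None] at the numbers that code no
    sentence. *)
Lemma sen_enumeration (S L : Type) (F : symbols S) : countable [set: S] ->
  countable [set: L] -> countable_symbols F ->
  exists e : nat -> option (sen L F), forall phi, exists j, e j = Some phi.
Proof.
move=> /countable_injection[cs csI] /countable_injection[cl clI].
move=> /countable_injection[c cI].
have cI' : symbols_code_inj (fun w s (f : F w s) => c (existT _ (w, s) f)).
  by move=> w s f w' s' f' /cI.
have inj := sen_code_inj csI clI cI'.
pose P j phi := pickle (sen_code cs cl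
  (fun w s (f : F w s) => c (existT _ (w, s) f)) phi) = j.
have /choice[e eP] : forall j, exists o : option (sen L F),
    forall phi, P j phi -> o = Some phi.
  move=> j; have [[phi Pphi]|nP] := pselect (exists phi, P j phi).
    exists (Some phi) => psi Ppsi; congr Some; apply: inj.
    by apply: (pcan_inj pickleK); rewrite Pphi Ppsi.
  by exists None => phi Pphi; case: nP; exists phi.
by exists e => phi; eexists; exact: eP.
Qed.

(** * The Henkin construction *)

Lemma entails_in (Sg : signature) (G : set (Sen Sg)) phi :
  G phi -> G |-- [set phi].
Proof. by move=> Gphi; apply: Monotonicity => _ ->. Qed.

Lemma entails_weak (Sg : signature) (G G' P : set (Sen Sg)) :
  G `<=` G' -> G |-- P -> G' |-- P.
Proof. by move=> GG'; apply: Transitivity; exact: Monotonicity. Qed.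

Lemma entails_cut (Sg : signature) (G : set (Sen Sg)) phi psi :
  G |-- [set phi] -> G `|` [set phi] |-- [set psi] -> G |-- [set psi].
Proof.
move=> Gphi; apply: Transitivity; apply: Union => chi [Gchi|->] //.
exact: entails_in.
Qed.

Lemma entails_true (Sg : signature) (G : set (Sen Sg)) :
  G |-- [set SNeg (SBot _ _)].
Proof. by apply/Neg_I/entails_in; right. Qed.

(** [Quant_E] for the existential closure of a provable sentence moves the derivation to the
    extension, and a cut then removes that sentence. *)
Lemma entails_incl (Sg : signature) (G : set (Sen Sg)) phi X :
  G |-- [set phi] ->
  @entails (ext_sig X) (sen_incl X @` G) [set sen_incl X phi].
Proof.
move=> Gphi; apply: (entails_cut (entails_true _)).
by apply: Quant_E; apply: entails_weak Gphi => psi; left.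
Qed.

Definition consistent (Sg : signature) (G : set (Sen Sg)) :=
  ~ G |-- [set SBot _ _].

Lemma consistent_neg (Sg : signature) (G : set (Sen Sg)) phi :
  G |-- [set phi] -> consistent G -> ~ G |-- [set SNeg phi].
Proof. by move=> Gphi Gc /Neg_E; exact: (contra_not (entails_cut Gphi) Gc). Qed.

(** Quantification over no variables is provable by the empty substitution, so [Quant_I] applies.
    This serves the steps that add no constant; with variables, empty carriers would obstruct it. *)
Lemma consistent_incl0 (Sg : signature) (G : set (Sen Sg)) :
  consistent G -> @consistent (ext_sig [::]) (sen_incl [::] @` G).
Proof.
move=> Gc GX; apply: Gc.
have Gex : G |-- [set SEx (X := [::]) (SNeg (SBot _ (ext (@sg_fn Sg) [::])))].
  apply: (Subst (theta := fun s (x : pos [::] s) =>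
    match x with PZ _ _ => idProp | PS _ _ _ _ => idProp end)).
  exact: entails_true.
apply: (entails_cut Gex).
by apply: Quant_I; apply: entails_weak GX => psi; left.
Qed.

Lemma consistent_or (Sg : signature) (G : set (Sen Sg)) phi :
  consistent G ->
  consistent (G `|` [set phi]) \/ consistent (G `|` [set SNeg phi]).
Proof.
move=> Gc; have [h|] := pselect (consistent (G `|` [set SNeg phi])).
  by right.
move=> /contrapT/Neg_I/Neg_D Gphi; left => /(entails_cut Gphi).
exact: Gc.
Qed.

(* The atoms and connectives not listed need no witness: their behaviour is
   settled by the completeness of the limit theory. *)
Definition witnessed (S L : Type) (F : symbols S) X
    (G : set (sen L (ext F X))) (phi : sen L F) : Prop :=
  match phi with
  | STr s (ASeq a1 a2) t1 t2 => exists x,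
      G (STr a1 (term_incl X t1) x) /\ G (STr a2 x (term_incl X t2))
  | STr s (AStar a) t1 t2 => exists n, G (sen_incl X (STrPow a n t1 t2))
  | SEx Y psi => exists2 r : forall w s, ext F Y w s -> ext F X w s,
      forall w s (f : F w s), r w s (Old Y f) = Old X f &
      G (sen_subst (fun w s f => ToFn (r w s f)) psi)
  | _ => True
  end.

Lemma term_subst_id (S : Type) (F : symbols S) s (t : term F s) :
  term_subst (fun w s f => ToFn f) t = t.
Proof.
by elim/term_hall_ind: t => w {}s f ts /= /hmap_ext_hall ->; rewrite hmap_id.
Qed.

Lemma sen_subst_id (S L : Type) (F : symbols S) (phi : sen L F) :
  sen_subst (fun w s f => ToFn f) phi = phi.
Proof.
elim/sen_In_ind: phi => {}F //=.
- by move=> s t1 t2; rewrite !term_subst_id.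
- by move=> s a t1 t2; rewrite !term_subst_id.
- by move=> phi ->.
- move=> Phi IH; congr SDisj; elim: Phi IH => //= phi Phi IHPhi IH.
  by rewrite IHPhi ?IH//; [left|move=> psi ?; apply: IH; right].
- move=> X phi IH; congr SEx; rewrite -[RHS]IH; congr (sen_subst _ phi).
  apply/functional_extensionality_dep => w.
  apply/functional_extensionality_dep => s.
  by apply/functional_extensionality_dep => -[].
Qed.

(** The sentence is accepted whenever this is consistent. Adding its witness then stays consistent
    by the contrapositive of [Comp_E], [Star_E] or [Quant_I]. *)
Lemma henkin_step (Sg : signature) (G : set (Sen Sg)) (o : option (Sen Sg)) :
  consistent G ->
  exists X (G' : set (Sen (ext_sig X))),
  [/\ consistent G', sen_incl X @` G `<=` G' &
      forall phi, o = Some phi ->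
        G' (sen_incl X phi) /\ witnessed G' phi \/
        G' (sen_incl X (SNeg phi))].
Proof.
move=> Gc; case: o => [phi|]; last first.
  by exists [::], (sen_incl [::] @` G); split=> //; exact: consistent_incl0.
have [Gphi|Gphi] := consistent_or phi Gc; last first.
  exists [::], (sen_incl [::] @` (G `|` [set SNeg phi])); split.
  - exact: consistent_incl0.
  - by move=> _ [psi ? <-]; exists psi => //; left.
  - by move=> _ [<-]; right; exists (SNeg phi) => //; right.
suff [X [G' [Gc' GG' w]]] : exists X (G' : set (Sen (ext_sig X))),
    [/\ consistent G', sen_incl X @` (G `|` [set phi]) `<=` G' &
        witnessed G' phi].
  exists X, G'; split=> //.
    by move=> _ [psi ? <-]; apply: GG'; exists psi => //; left.
  by move=> _ [<-]; left; split=> //; apply: GG'; exists phi => //; right.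
have Gphi0 := consistent_incl0 Gphi.
case: phi Gphi Gphi0 =>
  [s t1 t2|s [l|a1 a2|a1 a2|a] t1 t2|psi|Phi|X psi] Gphi Gphi0.
- by eexists; eexists; split; [exact: Gphi0| |].
- by eexists; eexists; split; [exact: Gphi0| |].
- pose x : Term (ext_sig [:: s]) s :=
    App (New (@sg_fn Sg) (PZ s [::])) (hnil _).
  exists [:: s], (sen_incl [:: s] @` (G `|` [set STr (ASeq a1 a2) t1 t2]) `|`
    [set STr a1 (term_incl [:: s] t1) x; STr a2 x (term_incl [:: s] t2)]).
  split.
  + move=> h; apply: Gphi.
    apply: (@Comp_E _ _ _ a1 a2 t1 t2 (SBot _ _)) h.
    by apply: entails_in; right.
  + by move=> psi ?; left.
  + by exists x; split; right; [left|right].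
- by eexists; eexists; split; [exact: Gphi0| |].
(* If every exponent led to a contradiction, the infinitary rule [Star_E] would refute the accepted
   sentence. *)
- have [n Gn] : exists n, consistent (G `|` [set STr (AStar a) t1 t2] `|`
      [set STrPow a n t1 t2]).
    apply: contrapT => /forallNP h; apply: Gphi.
    apply: (@Star_E _ _ _ a t1 t2) => [|n]; first by apply: entails_in; right.
    exact: contrapT (h n).
  exists [::], (sen_incl [::] @` (G `|` [set STr (AStar a) t1 t2] `|`
      [set STrPow a n t1 t2])); split.
  + exact: consistent_incl0.
  + by move=> _ [psi ? <-]; exists psi => //; left.
  + by exists n; exists (STrPow a n t1 t2) => //; right.
- by eexists; eexists; split; [exact: Gphi0| |].
- by eexists; eexists; split; [exact: Gphi0| |].
- exists X, (sen_incl X @` (G `|` [set SEx psi]) `|` [set psi]); split.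
  + move=> /(@Quant_I _ _ _ _ (SBot _ _)) h; apply: Gphi.
    by apply: entails_weak h => chi [//|->]; right.
  + by move=> chi ?; left.
  (* The bound variables themselves become the new constants, so the renaming is the identity. *)
  + by exists (fun w s f => f) => //; right; rewrite sen_subst_id.
Qed.

(* The order on [nat] as a type, so that inclusions between stages are defined
   by recursion on it. *)
Inductive leT (n : nat) : nat -> Type :=
| leT_n : leT n n
| leT_S m : leT n m -> leT n m.+1.

Fixpoint leT_trans n m k (p : leT n m) (q : leT m k) : leT n k :=
  match q with
  | leT_n => p
  | leT_S _ q' => leT_S (leT_trans p q')
  end.

Definition leT_succ n m (p : leT n.+1 m) : leT n m :=
  leT_trans (leT_S (leT_n n)) p.

Lemma leT_leq n m (p : leT n m) : n <= m.
Proof. by elim: p => // {}m _; exact: leqW. Qed.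

(** Makes the lifts below, which recurse on the proof of the inequality, independent of that
    proof. *)
Lemma leT_irr n m (p q : leT n m) : p = q.
Proof.
elim: p q => [|{}m p IH] q.
  refine (match q as q' in leT _ m return forall e : m = n,
    leT_n n = eq_rect m (leT n) q' n e
    with leT_n => _ | leT_S k l => _ end erefl).
    by move=> e; rewrite (eq_irrelevance e erefl).
  by move=> e; exfalso; have := leT_leq l; rewrite -e ltnn.
refine (match q as q' in leT _ m' return
   match m' return leT n m' -> Prop with
   | 0 => fun=> True
   | k.+1 => fun q => forall p : leT n k, (forall q, p = q) -> leT_S p = q
   end q' with leT_n => _ | leT_S k l => _ end p IH).
  move: {p q IH} n => [//|n] p.
  by have := leT_leq p; rewrite ltnn.
by move=> p' /(_ l) ->.
Qed.

Definition leT_addl n d : leT n (d + n) :=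
  (fix F d : leT n (d + n) :=
    match d with 0 => leT_n n | e.+1 => leT_S (F e) end) d.

Definition leT_of_leq n m (h : n <= m) : leT n m :=
  eq_rect _ (leT n) (leT_addl n (m - n)) _ (subnK h).

Lemma leT_total n m : leT n m + leT m n.
Proof.
by have [h|h] := pselect (n <= m); [left|right]; apply: leT_of_leq;
  case: leqP h => // /ltnW.
Qed.

(** * The tower of consistent stages and its limit theory *)

Section Tower.
Context (S L : Type) (S_count : countable [set: S])
  (L_count : countable [set: L]).

(* [st_agenda i j] is the [j]-th sentence of stage [i], included in the current
   stage; it is treated at the step coded by [(i, j)]. *)
Record stage := Stage {
  st_fn : symbols S;
  st_mono : forall w s, set (st_fn w s);
  st_th : set (sen L st_fn);
  st_agenda : nat -> nat -> option (sen L st_fn);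
  st_consistent : @consistent (Signature st_mono L) st_th;
  st_countable : countable_symbols st_fn
}.

Arguments st_th : clear implicits.

Definition st_sig (st : stage) : signature := Signature (@st_mono st) L.

Definition enum_sen (F : symbols S) (Fc : countable_symbols F) :
    nat -> option (sen L F) :=
  sval (cid (sen_enumeration S_count L_count Fc)).

Definition next_step (k : nat) (st : stage) :=
  cid (@henkin_step (st_sig st) (@st_th st)
    (st_agenda st (Cantor.of_nat k).1 (Cantor.of_nat k).2) (@st_consistent st)).

Definition next_vars (k : nat) (st : stage) : seq S := sval (next_step k st).

Definition next_th (k : nat) (st : stage) :
    set (sen L (ext (@st_fn st) (next_vars k st))) :=
  sval (cid (svalP (next_step k st))).

Arguments next_th : clear implicits.

Lemma next_thP (k : nat) (st : stage) (X := next_vars k st)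
    (G := next_th k st) :
  [/\ @consistent (@ext_sig (st_sig st) X) G,
      sen_incl X @` st_th st `<=` G &
      forall phi,
        st_agenda st (Cantor.of_nat k).1 (Cantor.of_nat k).2 = Some phi ->
        G (sen_incl X phi) /\ witnessed G phi \/ G (sen_incl X (SNeg phi))].
Proof. exact: (svalP (cid (svalP (next_step k st)))). Qed.

Lemma next_consistent (k : nat) (st : stage) :
  @consistent (@ext_sig (st_sig st) (next_vars k st)) (next_th k st).
Proof. by case: (next_thP k st). Qed.

(** The stage produced at step [k] has index [k + 1]: its own sentences fill that row of the agenda,
    and the other rows are carried along by inclusion. *)
Definition next (k : nat) (st : stage) : stage :=
  let Fc := countable_symbols_ext (next_vars k st) (@st_countable st) in
  @Stage (ext (@st_fn st) (next_vars k st))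
    (@ext_monotonic (st_sig st) (next_vars k st))
    (next_th k st)
    (fun i j => if i == k.+1 then enum_sen Fc j
                else omap (sen_incl (next_vars k st)) (st_agenda st i j))
    (@next_consistent k st)
    Fc.

Context (F0 : symbols S) (M0 : forall w s, set (F0 w s)) (G0 : set (sen L F0))
  (G0_consistent : @consistent (Signature M0 L) G0)
  (F0_countable : countable_symbols F0).

(** In the initial agenda the rows above 0 are placeholders. Row [i] is overwritten when stage [i]
    is created, and no step before that reads it, since a code of [(i, j)] is at least [i]. *)
Fixpoint tower (n : nat) : stage :=
  match n with
  | 0 => Stage (fun _ j => enum_sen F0_countable j) G0_consistent F0_countable
  | m.+1 => next m (tower m)
  end.

Definition Fn n : symbols S := st_fn (tower n).
Definition th n : set (sen L (Fn n)) := @st_th (tower n).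
Arguments th : clear implicits.

Definition vars n : seq S := next_vars n (tower n).

Fixpoint lift_fn n m (p : leT n m) w s (f : Fn n w s) : Fn m w s :=
  match p in leT _ m return Fn m w s with
  | leT_n => f
  | leT_S m p' => Old (vars m) (lift_fn p' f)
  end.

Fixpoint lift_term n m (p : leT n m) s (t : term (Fn n) s) : term (Fn m) s :=
  match p in leT _ m return term (Fn m) s with
  | leT_n => t
  | leT_S m p' => term_incl (vars m) (lift_term p' t)
  end.

Fixpoint lift n m (p : leT n m) (phi : sen L (Fn n)) : sen L (Fn m) :=
  match p in leT _ m return sen L (Fn m) with
  | leT_n => phi
  | leT_S m p' => sen_incl (vars m) (lift p' phi)
  end.

(* The inclusion between stages, below a quantifier over [X]. *)
Fixpoint lift_ext X n m (p : leT n m) (phi : sen L (ext (Fn n) X)) :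
    sen L (ext (Fn m) X) :=
  match p in leT _ m return sen L (ext (Fn m) X) with
  | leT_n => phi
  | leT_S m p' =>
      sen_subst (ext_subst (X := X) (@incl_subst _ (Fn m) (vars m)))
        (lift_ext p' phi)
  end.

Lemma lift_termA n m k (p : leT n m) (q : leT m k) s (t : term (Fn n) s) :
  lift_term (leT_trans p q) t = lift_term q (lift_term p t).
Proof. by elim: q => //= {}k q ->. Qed.

Lemma liftA n m k (p : leT n m) (q : leT m k) phi :
  lift (leT_trans p q) phi = lift q (lift p phi).
Proof. by elim: q => //= {}k q ->. Qed.

Lemma lift_fnA n m k (p : leT n m) (q : leT m k) w s (f : Fn n w s) :
  lift_fn (leT_trans p q) f = lift_fn q (lift_fn p f).
Proof. by elim: q => //= {}k q ->. Qed.

Lemma lift_App n m (p : leT n m) w s (f : Fn n w s) ts :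
  lift_term p (App f ts) = App (lift_fn p f) (hmap (lift_term p) ts).
Proof.
elim: p => [|{}m p IH] /=; first by rewrite hmap_id.
by rewrite IH /term_incl /= hmap_comp.
Qed.

Lemma lift_SEq n m (p : leT n m) s (t1 t2 : term (Fn n) s) :
  lift p (SEq L t1 t2) = SEq L (lift_term p t1) (lift_term p t2).
Proof. by elim: p => //= {}m p ->. Qed.

Lemma lift_STr n m (p : leT n m) a s (t1 t2 : term (Fn n) s) :
  lift p (STr a t1 t2) = STr a (lift_term p t1) (lift_term p t2).
Proof. by elim: p => //= {}m p ->. Qed.

Lemma lift_SNeg n m (p : leT n m) phi :
  lift p (SNeg phi) = SNeg (lift p phi).
Proof. by elim: p => //= {}m p ->. Qed.

Lemma lift_SEx n m (p : leT n m) X (phi : sen L (ext (Fn n) X)) :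
  lift p (SEx phi) = SEx (lift_ext p phi).
Proof. by elim: p => //= {}m p ->. Qed.

Lemma lift_mono n m (p : leT n m) w s (f : Fn n w s) :
  @st_mono (tower n) w s f -> @st_mono (tower m) w s (lift_fn p f).
Proof. by elim: p. Qed.

Lemma th_lift n m (p : leT n m) phi : th n phi -> th m (lift p phi).
Proof.
move=> h; elim: p => //= {}m p IH.
by have [_ + _] := next_thP m (tower m); apply; exists (lift p phi).
Qed.

(* The limit theory, seen from stage [n]. *)
Definition limit_th n (phi : sen L (Fn n)) :=
  exists m (p : leT n m), th m (lift p phi).

(** A sentence found before stage [m] persists up to [m], because the theories grow along the
    tower. *)
Lemma limit_th_lift n m (p : leT n m) phi :
  limit_th (lift p phi) <-> limit_th phi.
Proof.
split=> [[k [q h]]|[k [q h]]].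
  by exists k, (leT_trans p q); rewrite liftA.
have [r|r] := leT_total m k.
  by exists k, r; rewrite -liftA (leT_irr (leT_trans p r) q).
exists m, (leT_n m); rewrite /= (leT_irr p (leT_trans q r)) liftA.
exact: th_lift.
Qed.

(** The latest of finitely many stages contains them all. This is what replaces consistency of the
    limit. *)
Lemma limit_th_joint n (Phi : seq (sen L (Fn n))) :
  (forall phi, List.In phi Phi -> limit_th phi) ->
  exists m (p : leT n m), forall phi, List.In phi Phi -> th m (lift p phi).
Proof.
elim: Phi => [_|phi Phi IH h]; first by exists n, (leT_n n).
have [k [q Phik]] := IH (fun psi hpsi => h psi (or_intror hpsi)).
have [m [p phim]] := h phi (or_introl erefl).
have [r|r] := leT_total m k.
  exists k, q => psi /= [<-|/Phik//].
  by rewrite (leT_irr q (leT_trans p r)) liftA; exact: th_lift.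
exists m, p => psi /= [<-//|/Phik].
by rewrite (leT_irr p (leT_trans q r)) liftA; exact: th_lift.
Qed.

Lemma lift_entails n m (p : leT n m) (G : set (sen L (Fn n))) phi :
  @entails (st_sig (tower n)) G [set phi] ->
  @entails (st_sig (tower m)) (lift p @` G) [set lift p phi].
Proof.
move=> h; elim: p => [|{}m p IH] /=; first by rewrite image_id.
rewrite -(image_comp (lift p) (sen_incl (vars m))).
exact: (@entails_incl (st_sig (tower m))).
Qed.

Lemma agenda_lift n m (p : leT n m) j :
  st_agenda (tower m) n j =
  omap (lift p) (enum_sen (@st_countable (tower n)) j).
Proof.
elim: p => [|{}m p IH].
  by case: n => [|n] /=; rewrite ?eqxx; case: enum_sen.
rewrite /= IH ltn_eqF; last by rewrite ltnS; exact: leT_leq p.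
by case: enum_sen.
Qed.

(** Fairness: [phi] has some number [j] at stage [n], and the step coded by [(n, j)] is not earlier
    than [n], so it treats the lift of [phi]. *)
Lemma tower_treats n (phi : sen L (Fn n)) :
  exists m (p : leT n m),
    th m.+1 (lift (leT_S p) phi) /\
      @witnessed _ _ (Fn m) (vars m) (th m.+1) (lift p phi) \/
    th m.+1 (lift (leT_S p) (SNeg phi)).
Proof.
have [j ej] := svalP (cid (sen_enumeration S_count L_count
  (@st_countable (tower n)))) phi.
pose m := Cantor.to_nat (n, j).
have nm : n <= m.
  have /leP := Cantor.to_nat_non_decreasing n j.
  by apply: leq_trans; rewrite leq_addl.
pose p := leT_of_leq nm; exists m, p.
have [_ _] := next_thP m (tower m); rewrite Cantor.cancel_of_to /=.
move/(_ (lift p phi)); rewrite lift_SNeg; apply.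
by rewrite (agenda_lift p) /enum_sen ej.
Qed.

(** * Completeness and deductive closure of the limit theory *)

Lemma limit_th_dec n phi : @limit_th n phi \/ @limit_th n (SNeg phi).
Proof.
have [m [p [[h _]|h]]] := tower_treats phi; [left|right].
  by exists m.+1, (leT_S p).
by exists m.+1, (leT_S p).
Qed.

(** Otherwise the negation of [phi] and the finitely many premises would meet in one stage and make
    it inconsistent. *)
Lemma limit_th_entails n (Phi : seq (sen L (Fn n))) phi :
  (forall psi, List.In psi Phi -> limit_th psi) ->
  @entails (st_sig (tower n)) [set psi | List.In psi Phi] [set phi] ->
  limit_th phi.
Proof.
move=> Phith Phiphi; have [//|nphi] := limit_th_dec phi.
have [m [p h]] := @limit_th_joint n (SNeg phi :: Phi) (fun psi hpsi =>
  match hpsi with or_introl e => eq_ind _ _ nphi _ e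
                | or_intror h => Phith psi h end).
exfalso; apply: (@consistent_neg (st_sig (tower m)) (th m) (lift p phi)).
- apply: entails_weak (lift_entails p Phiphi) => _ [psi Phipsi <-].
  by apply: h; right.
- exact: st_consistent.
- by rewrite -lift_SNeg; apply: entails_in; apply: h; left.
Qed.

Lemma limit_th_neg n phi : @limit_th n (SNeg phi) <-> ~ @limit_th n phi.
Proof.
split=> [nphi hphi|]; last by have [|//] := limit_th_dec phi.
have [m [p h]] : @limit_th n (SBot L (Fn n)).
  apply: (@limit_th_entails n [:: phi; SNeg phi]).
    by move=> psi /= [<-//|[<-//|[]]].
  have h : @entails (st_sig (tower n))
      [set psi | List.In psi [:: phi; SNeg phi]] [set SNeg phi].
    by apply: entails_in; right; left.
  by apply: entails_cut (Neg_E h); apply: entails_in; left.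
apply: (@st_consistent (tower m)); apply: entails_in.
suff <- : lift p (SBot L (Fn n)) = SBot L (Fn m) by [].
by elim: p {h} => //= {}m p ->.
Qed.

Lemma limit_th_witnessed n (phi : sen L (Fn n)) : limit_th phi ->
  exists m (p : leT n m),
    @witnessed _ _ (Fn m) (vars m) (th m.+1) (lift p phi).
Proof.
move=> hphi; have [m [p [[_ h]|h]]] := tower_treats phi; first by exists m, p.
suff : limit_th (SNeg phi) by move/limit_th_neg.
by exists m.+1, (leT_S p).
Qed.

Lemma limit_th_disj n (Phi : seq (sen L (Fn n))) :
  limit_th (SDisj Phi) <-> exists2 phi, List.In phi Phi & limit_th phi.
Proof.
split=> [h|[phi Phiphi h]]; last first.
  apply: (@limit_th_entails n [:: phi]); first by move=> psi /= [<-|[]].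
  by apply: (@Disj_I (st_sig (tower n))) Phiphi; apply: entails_in; left.
apply: contrapT => /forall2NP nPhi.
(* If no disjunct is in the limit, all their negations are, and these finitely many sentences refute
   the disjunction. *)
suff : limit_th (SNeg (SDisj Phi)) by move/limit_th_neg.
apply: (@limit_th_entails n (map (@SNeg _ _ _) Phi)).
  move=> psi /List.in_map_iff[phi [<- Phiphi]]; apply/limit_th_neg.
  by case: (nPhi phi).
apply: Neg_I; apply: (@Disj_E (st_sig (tower n)) _ Phi).
  by apply: entails_in; right.
move=> phi Phiphi; apply: Neg_E; apply: entails_in; left.
exact/List.in_map_iff/(ex_intro _ phi).
Qed.

Lemma limit_th_union n a1 a2 s (t1 t2 : term (Fn n) s) :
  limit_th (STr (AUnion a1 a2) t1 t2) <->
  limit_th (STr a1 t1 t2) \/ limit_th (STr a2 t1 t2).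
Proof.
split=> [h|].
  have : limit_th (SDisj [:: STr a1 t1 t2; STr a2 t1 t2]).
    apply: (@limit_th_entails n [:: STr (AUnion a1 a2) t1 t2]).
      by move=> psi /= [<-|[]].
    apply: (@Union_E (st_sig (tower n)) _ _ a1 a2 t1 t2).
    - by apply: entails_in; left.
    - by apply: Disj_I; [apply: entails_in; right|left].
    - by apply: Disj_I; [apply: entails_in; right|right; left].
  by move=> /limit_th_disj[psi /= [<-|[<-|[]]] ?]; [left|right].
move=> [h|h]; [apply: (@limit_th_entails n [:: STr a1 t1 t2])|
               apply: (@limit_th_entails n [:: STr a2 t1 t2])].
- by move=> psi /= [<-|[]].
- by apply: Union_I1; apply: entails_in; left.
- by move=> psi /= [<-|[]].
- by apply: Union_I2; apply: entails_in; left.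
Qed.

Lemma limit_th_refl n s (t : term (Fn n) s) : limit_th (SEq L t t).
Proof.
apply: (@limit_th_entails n [::]) => //.
exact: (@Rule_R (st_sig (tower n))).
Qed.

Lemma limit_th_sym n s (t1 t2 : term (Fn n) s) :
  limit_th (SEq L t1 t2) -> limit_th (SEq L t2 t1).
Proof.
move=> h; apply: (@limit_th_entails n [:: SEq L t1 t2]).
  by move=> psi /= [<-|[]].
by apply: (@Rule_S (st_sig (tower n))); apply: entails_in; left.
Qed.

Lemma limit_th_trans n s (t1 t2 t3 : term (Fn n) s) :
  limit_th (SEq L t1 t2) -> limit_th (SEq L t2 t3) -> limit_th (SEq L t1 t3).
Proof.
move=> h1 h2; apply: (@limit_th_entails n [:: SEq L t1 t2; SEq L t2 t3]).
  by move=> psi /= [<-|[<-|[]]].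
apply: (@Rule_T (st_sig (tower n)) _ _ _ t2); apply: entails_in; first by left.
by right; left.
Qed.

(** * The term model of the limit theory *)

(** A class gathers terms of all stages, compared at a common later one. All stages thus share one
    carrier, and each model of the tower expands the preceding one. *)
Definition term_class n s (t : term (Fn n) s) : set {m & term (Fn m) s} :=
  fun u => exists k (p : leT n k) (q : leT (projT1 u) k),
    limit_th (SEq L (lift_term p t) (lift_term q (projT2 u))).

Definition classes (s : S) : Type :=
  {P : set {m & term (Fn m) s} |
   exists n (t : term (Fn n) s), P = term_class t}.

Definition cls n s (t : term (Fn n) s) : classes s :=
  exist _ (term_class t) (ex_intro _ n (ex_intro _ t erefl)).

Lemma classes_inj s (x y : classes s) : sval x = sval y -> x = y.
Proof.
case: x y => [P hP] [P' hP'] /= e; case: _ / e hP' => hP'.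
by congr exist; exact: Prop_irrelevance.
Qed.

Lemma cls_surj s (x : classes s) : exists n (t : term (Fn n) s), x = cls t.
Proof. by case: x => P [n [t e]]; exists n, t; apply: classes_inj. Qed.

Lemma term_class_sub n s (t t' : term (Fn n) s) :
  limit_th (SEq L t t') -> term_class t `<=` term_class t'.
Proof.
move=> h u [k [p [q hu]]]; exists k, p, q; apply: limit_th_trans hu.
by apply: limit_th_sym; rewrite -lift_SEq limit_th_lift.
Qed.

Lemma cls_eq n s (t t' : term (Fn n) s) :
  cls t = cls t' <-> limit_th (SEq L t t').
Proof.
split=> [/(congr1 sval)/= e|h].
  have : term_class t' (existT _ n t').
    by exists n, (leT_n n), (leT_n n); exact: limit_th_refl.
  rewrite -e => -[k [p [q]]] /=.
  by rewrite (leT_irr q p) -lift_SEq limit_th_lift.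
apply: classes_inj => /=; rewrite eqEsubset; split; apply: term_class_sub => //.
exact: limit_th_sym.
Qed.

Lemma leT_common n m : exists k (p : leT n k) (q : leT m k), True.
Proof.
have [r|r] := leT_total n m.
  by exists m, r, (leT_n m).
by exists n, (leT_n n), r.
Qed.

Lemma cls_lift n m (p : leT n m) s (t : term (Fn n) s) :
  cls (lift_term p t) = cls t.
Proof.
apply: classes_inj => /=; rewrite eqEsubset; split=> u [k [q [r h]]].
  by exists k, (leT_trans p q), r; rewrite lift_termA.
have [k' [q' [r' _]]] := leT_common m k.
exists k', q', (leT_trans r r').
rewrite -lift_termA (leT_irr (leT_trans p q') (leT_trans q r')) !lift_termA.
by rewrite -lift_SEq limit_th_lift.
Qed.

Lemma hmap_cls_lift n m (p : leT n m) w (ts : hlist (term (Fn n)) w) :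
  hmap (@cls m) (hmap (lift_term p) ts) = hmap (@cls n) ts.
Proof.
rewrite hmap_comp; congr (hmap _ ts).
by apply/functional_extensionality_dep => s; apply/funext => t; exact: cls_lift.
Qed.

(** Finitely many classes have representatives at one common stage, which can be taken beyond any
    given [n]. *)
Lemma hlist_cls_surj w (args : hlist classes w) n :
  exists k (p : leT n k) (ts : hlist (term (Fn k)) w),
    args = hmap (@cls k) ts.
Proof.
elim: args => [|s {}w x args [k [p [ts ->]]]].
  by exists n, (leT_n n), (hnil _).
have [m [t ->]] := cls_surj x.
have [k' [q [r _]]] := leT_common m k.
exists k', (leT_trans p r), (hcons (lift_term q t) (hmap (lift_term r) ts)).
by rewrite /= cls_lift hmap_cls_lift.
Qed.

Fixpoint hlist_eqs (F : symbols S) w :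
    hlist (term F) w -> hlist (term F) w -> seq (sen L F) :=
  match w with
  | [::] => fun _ _ => [::]
  | s :: w' => fun ts ts' =>
      SEq L (hhead ts) (hhead ts') :: hlist_eqs (htail ts) (htail ts')
  end.

Lemma hlist_eqs_in (F : symbols S) w (ts ts' : hlist (term F) w) s
    (i : pos w s) :
  List.In (SEq L (hnth i ts) (hnth i ts')) (hlist_eqs ts ts').
Proof.
by elim: i ts ts' => [{}s {}w|{}s s' {}w i IH] ts ts' /=; [left|right].
Qed.

Lemma hlist_eqs_limit n w (ts ts' : hlist (term (Fn n)) w) :
  hmap (@cls n) ts = hmap (@cls n) ts' ->
  forall psi, List.In psi (hlist_eqs ts ts') -> limit_th psi.
Proof.
elim: w ts ts' => [//|s w IH] ts ts'.
rewrite (hlist_cons ts) (hlist_cons ts') /= => e psi [<-|].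
  by apply/cls_eq; exact: (congr1 (@hhead _ _ _ _) e).
by apply: IH; exact: (congr1 (@htail _ _ _ _) e).
Qed.

Lemma cls_App n w s (f : Fn n w s) ts ts' :
  hmap (@cls n) ts = hmap (@cls n) ts' -> cls (App f ts) = cls (App f ts').
Proof.
move=> e; apply/cls_eq; apply: limit_th_entails (hlist_eqs_limit e) _.
apply: (@Rule_F (st_sig (tower n))) => s' i; apply: entails_in.
exact: hlist_eqs_in.
Qed.

(** Well-definedness of the operations: two choices of stage and representatives are compared at a
    common later stage, by the congruence rule. *)
Lemma class_interp_exists w s (f : Fn 0 w s) (args : hlist classes w) :
  exists y : classes s, forall k (p : leT 0 k) (ts : hlist (term (Fn k)) w),
    args = hmap (@cls k) ts -> y = cls (App (lift_fn p f) ts).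
Proof.
have [m [q [us ->]]] := hlist_cls_surj args 0.
exists (cls (App (lift_fn q f) us)) => k p ts e.
have [k' [r [r' _]]] := leT_common m k.
rewrite -(cls_lift r) -(cls_lift r') !lift_App -!lift_fnA.
rewrite (leT_irr (leT_trans p r') (leT_trans q r)).
by apply: cls_App; rewrite !hmap_cls_lift.
Qed.

(** Added constants denote their own classes and older symbols keep their meaning, so reducts along
    the inclusions of stages agree by computation. *)
Fixpoint class_interp n :
    forall w s, Fn n w s -> hlist classes w -> classes s :=
  match n with
  | 0 => fun w s f args => sval (cid (class_interp_exists f args))
  | m.+1 => fun w s f =>
      match f in ext _ _ w s return hlist classes w -> classes s with
      | Old w s g => @class_interp m w s g
      | New s x => fun _ =>
          @cls m.+1 s (App (New (Fn m) x) (hnil _) : term (Fn m.+1) s)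
      end
  end.

Definition class_trans (l : L) s (x y : classes s) : Prop :=
  exists n (t t' : term (Fn n) s),
    [/\ x = cls t, y = cls t' & limit_th (STr (ALab l) t t')].

Definition term_structure n : structure L (Fn n) :=
  Structure (@class_interp n) class_trans.

Lemma class_interp_cls n w s (f : Fn n w s) k (p : leT n k)
    (ts : hlist (term (Fn k)) w) :
  class_interp f (hmap (@cls k) ts) = cls (App (lift_fn p f) ts).
Proof.
elim: n w s f p ts => [|n IH] w s f p ts.
  exact: (svalP (cid (class_interp_exists f _))).
have lift_succ w' s' (g : Fn n w' s') :
    lift_fn (leT_succ p) g = lift_fn p (Old (vars n) g).
  by rewrite /leT_succ lift_fnA.
case: f ts => [{}w {}s f|{}s x] ts.
  by rewrite -lift_succ; exact: IH.
rewrite (hlist0 ts) /= -(cls_lift p); congr cls.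
exact: (@lift_App n.+1).
Qed.

Lemma eval_cls n s (t : term (Fn n) s) : eval (term_structure n) t = cls t.
Proof.
elim/term_hall_ind: t => w {}s f ts /hmap_ext_hall /= ->.
exact: (class_interp_cls f (leT_n n)).
Qed.

Lemma sat_lift n m (p : leT n m) phi :
  sat (lift p phi) (term_structure m) <-> sat phi (term_structure n).
Proof. by elim: p => //= {}m p <-; rewrite /sen_incl sat_subst. Qed.

Lemma sat_lift_ext X n m (p : leT n m) (phi : sen L (ext (Fn n) X))
    (v : forall s, pos X s -> classes s) :
  sat (lift_ext p phi) (expansion (A := term_structure m) v) <->
  sat phi (expansion (A := term_structure n) v).
Proof.
elim: p => //= {}m p <-.
by rewrite sat_subst subst_reduct_expansion.
Qed.

(** The representatives witnessing the transition may live at another stage; both pairs are lifted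
    to a common one, where [Rule_P] replaces equals. *)
Lemma class_trans_cls l n s (t t' : term (Fn n) s) :
  class_trans l (cls t) (cls t') <-> limit_th (STr (ALab l) t t').
Proof.
split=> [[m [u [u' [e e' h]]]]|h]; last by exists n, t, t'.
have [k [p [q _]]] := leT_common n m.
rewrite -(limit_th_lift p) lift_STr.
move: e e' h; rewrite -2!(cls_lift p) -2!(cls_lift q).
move=> /esym/cls_eq e /esym/cls_eq e'.
rewrite -(limit_th_lift q) lift_STr => h.
apply: (@limit_th_entails k [:: SEq L (lift_term q u) (lift_term p t);
  SEq L (lift_term q u') (lift_term p t');
  STr (ALab l) (lift_term q u) (lift_term q u')]).
  by move=> psi /= [<-|[<-|[<-|[]]]].
apply: (@Rule_P (st_sig (tower k))); apply: entails_in; first by left.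
  by right; left.
by right; right; left.
Qed.

(** * Truth of transitions and of sentences in the term model *)

Lemma limit_th_seq n a1 a2 s (t t' : term (Fn n) s) :
  limit_th (STr (ASeq a1 a2) t t') <->
  exists m (p : leT n m) (x : term (Fn m) s),
    limit_th (STr a1 (lift_term p t) x) /\ limit_th (STr a2 x (lift_term p t')).
Proof.
split=> [/limit_th_witnessed[m [p]]|[m [p [x [h1 h2]]]]].
  rewrite lift_STr => -[x [h1 h2]]; exists m.+1, (leT_S p), x; split.
    by exists m.+1, (leT_n m.+1).
  by exists m.+1, (leT_n m.+1).
rewrite -(limit_th_lift p) lift_STr.
apply: (@limit_th_entails m [:: STr a1 (lift_term p t) x;
   STr a2 x (lift_term p t')]).
  by move=> psi /= [<-|[<-|[]]].
apply: (@Comp_I (st_sig (tower m)) _ _ _ _ _ x); apply: entails_in.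
  by left.
by right; left.
Qed.

Lemma lift_STrPow n m (p : leT n m) a i s (t t' : term (Fn n) s) :
  lift p (STrPow a i t t') = STrPow a i (lift_term p t) (lift_term p t').
Proof. by case: i => [|i]; [exact: lift_SEq|exact: lift_STr]. Qed.

Lemma limit_th_star n a s (t t' : term (Fn n) s) :
  limit_th (STr (AStar a) t t') <-> exists i, limit_th (STrPow a i t t').
Proof.
split=> [/limit_th_witnessed[m [p]]|[i h]].
  rewrite lift_STr => -[i]; rewrite -lift_STrPow => h.
  by exists i; exists m.+1, (leT_S p).
apply: (@limit_th_entails n [:: STrPow a i t t']).
  by move=> psi /= [<-|[]].
by apply: (@Star_I (st_sig (tower n)) _ _ _ i); apply: entails_in; left.
Qed.

(** The stage [n] of the terms is independent of [N], since the midpoint of a composition may only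
    be named later. *)
Definition action_truth N (a : action L) :=
  forall n s (t t' : term (Fn n) s),
  @action_rel _ _ _ (term_structure N) a s (cls t) (cls t') <->
  limit_th (STr a t t').

Lemma action_truth_seq N a1 a2 :
  action_truth N a1 -> action_truth N a2 -> action_truth N (ASeq a1 a2).
Proof.
move=> IH1 IH2 n s t t'; rewrite limit_th_seq; split=> /=.
  move=> [z]; have [m [x ->]] := cls_surj z.
  have [k [p [q _]]] := leT_common n m.
  rewrite -(cls_lift p t) -(cls_lift p t') -(cls_lift q x) IH1 IH2 => h.
  by exists k, p, (lift_term q x).
move=> [m [p [x]]]; rewrite -IH1 -IH2 !cls_lift => h.
by exists (cls x).
Qed.

Lemma action_truth_all N a : action_truth N a.
Proof.
elim: a => [l|a1 IH1 a2 IH2|a1 IH1 a2 IH2|a IH].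
- by move=> n s t t'; exact: class_trans_cls.
- exact: action_truth_seq.
- by move=> n s t t'; rewrite limit_th_union /= IH1 IH2.
- move=> n s t t'; rewrite action_rel_star limit_th_star.
  (* Positive powers are iterated compositions, so the hypothesis on [a] reaches them all; the
     zeroth power is an equation of classes. *)
  have IHi i : action_truth N (iter i (ASeq a) a).
    by elim: i => //= i; exact: action_truth_seq.
  split=> [[/cls_eq h|[i /IHi h]]|[[|i] /= h]].
  + by exists 0.
  + by exists i.+1.
  + by left; apply/cls_eq.
  + by right; exists i; apply/IHi.
Qed.

(** Ignores terms and actions, hence is invariant under substitution and lifting. *)
Fixpoint sen_size (F : symbols S) (phi : sen L F) : nat :=
  match phi with
  | SEq _ _ _ | STr _ _ _ _ => 0
  | SNeg psi => (sen_size psi).+1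
  | SDisj Phi => (sumn (map (@sen_size F) Phi)).+1
  | SEx X psi => (sen_size psi).+1
  end.

Lemma sen_size_subst (F F' : symbols S) (r : subst F F') (phi : sen L F) :
  sen_size (sen_subst r phi) = sen_size phi.
Proof.
elim/sen_In_ind: phi F' r => {}F //=.
- by move=> phi IH F' r; rewrite IH.
- move=> Phi IH F' r; congr _.+1; elim: Phi IH => //= phi Phi IHPhi IH.
  rewrite (IH phi (or_introl erefl)) IHPhi // => psi h.
  by apply: IH; right.
- by move=> X phi IH F' r; rewrite IH.
Qed.

Lemma sen_size_lift_ext X n m (p : leT n m) (phi : sen L (ext (Fn n) X)) :
  sen_size (lift_ext p phi) = sen_size phi.
Proof. by elim: p => //= {}m p <-; rewrite sen_size_subst. Qed.

Lemma sen_size_in (F : symbols S) (Phi : seq (sen L F)) phi :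
  List.In phi Phi -> sen_size phi <= sumn (map (@sen_size F) Phi).
Proof.
elim: Phi => //= psi Phi IH [->|/IH h]; first exact: leq_addr.
by apply: leq_trans h _; exact: leq_addl.
Qed.

(** Turns the syntactic witness of a quantified sentence into a valuation: each variable takes the
    value of the symbol it is renamed to. *)
Lemma rename_reduct_expansion n X
    (r : forall w s, ext (Fn n) X w s -> ext (Fn n) (vars n) w s) :
  (forall w s (f : Fn n w s), r w s (Old X f) = Old (vars n) f) ->
  exists v : forall s, pos X s -> classes s,
    subst_reduct (fun w s f => ToFn (r w s f)) (term_structure n.+1) =
    expansion (A := term_structure n) v.
Proof.
move=> rOld.
exists (fun s x => @class_interp n.+1 _ _ (r _ _ (New (Fn n) x)) (hnil _)).
congr Structure.
apply/functional_extensionality_dep => w.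
apply/functional_extensionality_dep => s.
apply/functional_extensionality_dep => -[{}w {}s f|{}s x] /=.
  by rewrite rOld.
by apply/funext => args; rewrite (hlist0 args).
Qed.

(** The induction is on size because the quantifier case passes to an instance at another stage,
    which is not a subformula. *)
Lemma truth n (phi : sen L (Fn n)) :
  sat phi (term_structure n) <-> limit_th phi.
Proof.
have [k] := ubnP (sen_size phi); elim: k n phi => // k IH n.
case=> [s t1 t2|s a t1 t2|phi|Phi|X phi] size_phi.
- by rewrite /= !eval_cls; exact: cls_eq.
- by rewrite /= !eval_cls; exact: action_truth_all.
- by rewrite limit_th_neg -IH.
- rewrite limit_th_disj sat_disj.
  split=> -[phi Phiphi h]; exists phi => //; apply/IH => //.
    exact: leq_ltn_trans (sen_size_in Phiphi) _.
  exact: leq_ltn_trans (sen_size_in Phiphi) _.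
- split.
    (* The finitely many values of [v] are named by terms of one stage [m]; substituting these terms
       yields an instance from which [Subst] concludes. *)
    move=> [v h]; have [l lv] := hlist_of_fun v.
    have [m [p [ts lts]]] := hlist_cls_surj l n.
    pose theta s (x : pos X s) := hnth x ts.
    have vE : v = fun s x => eval (term_structure m) (theta s x).
      apply/functional_extensionality_dep => s; apply/funext => x.
      by rewrite eval_cls -lv lts hmap_hnth.
    have {h} : sat (lift_ext p phi) (expansion (A := term_structure m) v).
      exact/sat_lift_ext.
    rewrite vE -subst_reduct_inst -sat_subst IH; last first.
      by rewrite sen_size_subst sen_size_lift_ext.
    rewrite -(limit_th_lift p) lift_SEx => h.
    apply: (@limit_th_entails m [:: sen_inst theta (lift_ext p phi)]).
      by move=> psi /= [<-|[]].
    apply: (@Subst (st_sig (tower m)) _ _ _ theta).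
    by apply: entails_in; left.
  move=> /limit_th_witnessed[m [p]]; rewrite lift_SEx => -[r rOld h].
  rewrite -(sat_lift p) lift_SEx.
  have [v rv] := rename_reduct_expansion rOld.
  exists v; rewrite -rv -sat_subst; apply/(IH m.+1).
    by rewrite sen_size_subst sen_size_lift_ext.
  by exists m.+1, (leT_n m.+1).
Qed.

Lemma term_structure_monotone :
  forall w s (f : F0 w s), M0 f ->
    forall (l : L) s' (k : pos w s') (args : hlist classes w) (b : classes s'),
    class_trans l (hnth k args) b ->
    class_trans l (@class_interp 0 w s f args)
      (@class_interp 0 w s f (hset k args b)).
Proof.
move=> w s f fM l s' j args b.
(* Consing [b] onto the arguments gives all of them representatives at the same stage, where
   [Rule_M] applies. *)
have [k [p [us]]] := hlist_cls_surj (hcons b args) 0.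
rewrite (hlist_cons us); set u := hhead us; set ts := htail us => e.
have -> : b = cls u by exact: (congr1 (@hhead _ _ _ _) e).
have -> : args = hmap (@cls k) ts by exact: (congr1 (@htail _ _ _ _) e).
rewrite -hmap_hset hmap_hnth !(class_interp_cls (n := 0) _ p) !class_trans_cls.
move=> h; apply: (@limit_th_entails k [:: STr (ALab l) (hnth j ts) u]).
  by move=> psi /= [<-|[]].
apply: (@Rule_M (st_sig (tower k))); first exact: (@lift_mono 0 k p).
by apply: entails_in; left.
Qed.

Lemma consistent_model : exists A : model (Signature M0 L),
  forall phi, G0 phi -> sat phi A.
Proof.
exists (@Model (Signature M0 L) (term_structure 0) term_structure_monotone).
by move=> phi Gphi; apply/(@truth 0); exists 0, (leT_n 0).
Qed.

End Tower.

Theorem theorem5p5 (Sg : signature) (hSg : countable_signature Sg)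
    (G : set (Sen Sg)) (phi : Sen Sg) :
  entails G (set1 phi) <-> consequence G phi.
Proof.
split=> [h A AG|Gphi]; first exact: (soundness h AG).
apply: contrapT => nGphi.
case: Sg hSg G phi Gphi nGphi => S F M L [/= Sc Fc Lc] G phi Gphi nGphi.
(* An inconsistency would give the double negation of [phi], hence a derivation of [phi]. *)
have Gc : @consistent (Signature M L) (G `|` [set SNeg phi]).
  by move=> /Neg_I/Neg_D.
have [A AG] := consistent_model Sc Lc Gc Fc.
apply: (AG (SNeg phi)); first by right.
by apply: Gphi => psi Gpsi; apply: AG; left.
Qed.
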